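(* Every graph $G$ with $m$ edges, $m$ sufficiently large, satisfying $$\rho(G)>\frac{1+\sqrt{4m-3}}{2}$$ contains at least $\left(\frac29-o(1)\right)m^2$ copies of $C_5$, where $o(1)\to0$ as $m\to\infty$, and the constant $\frac29$ is asymptotically best possible.
   Context: All graphs are finite and simple. $\rho(G)$ is the spectral radius of the adjacency matrix of $G$. Copies of $C_5$ are unoriented, i.e. subgraphs of $G$ isomorphic to the cycle on 5 vertices. The $o(1)$ term depends only on $m$. ''Asymptotically best possible'' means $2/9$ cannot be replaced by any larger constant in the lower bound for all sufficiently large $m$. *)

(* Defs.v *)
From HB Require Import structures.
From mathcomp Require Import all_boot all_order all_algebra.
From mathcomp Require Import complex.
From mathcomp Require Import all_classical all_reals all_analysis.

Set Implicit Arguments.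
Unset Strict Implicit.
Unset Printing Implicit Defensive.

Import Order.TTheory GRing.Theory Num.Theory.
Import numFieldNormedType.Exports.

Local Open Scope classical_set_scope.
Local Open Scope ring_scope.

Record sgraph := SGraph {
  vertex :> finType;
  adj : rel vertex;
  adj_sym : symmetric adj;
  adj_irrefl : irreflexive adj }.

Definition edges (G : sgraph) : {set {set G}} :=
  [set [set p.1; p.2]%SET | p : G * G & adj p.1 p.2]%SET.

Definition num_edges (G : sgraph) : nat := #|edges G|.

Definition adj_mx (K : nzRingType) (G : sgraph) : 'M[K]_#|G| :=
  \matrix_(i, j) (adj (enum_val i) (enum_val j))%:R.

(* Largest modulus of a complex eigenvalue; the value is 0 when n = 0, where
   there are no eigenvalues. *)
Definition spectral_radius (R : realType) (n : nat) (A : 'M[R]_n) : R :=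
  sup [set ComplexField.Normc.normc z |
        z in [set z : R[i] | eigenvalue (map_mx (real_complex R) A) z]].

Definition rho (R : realType) (G : sgraph) : R :=
  spectral_radius (adj_mx R G).

Definition C5_adj : rel 'I_5 := fun i j => (j == ordS i) || (i == ordS j).

Lemma C5_adj_sym : symmetric C5_adj.
Proof. by move=> i j; rewrite /C5_adj orbC. Qed.

Lemma C5_adj_irrefl : irreflexive C5_adj.
Proof. by case=> [[|[|[|[|[|i]]]]] hi]. Qed.

Definition C5 : sgraph := SGraph C5_adj_sym C5_adj_irrefl.

(* A subgraph of G is a pair (vertex set, edge set); the copies of H are the
   subgraphs of G onto which some injection of vertices transports H.  Several
   injections may give the same copy, which is then counted once. *)
Definition copies (H G : sgraph) : {set {set G} * {set {set G}}} :=
  [set S : {set G} * {set {set G}} | (S.2 \subset edges G) &&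
    [exists f : {ffun H -> G},
      [&& injectiveb f,
          S.1 == [set f x | x : H]%SET &
          S.2 == [set [set f x | x in A] | A : {set H} in edges H]%SET]]]%SET.

Definition num_C5 (G : sgraph) : nat := #|copies C5 G|.

Definition C5_lower_bound (R : realType) (c : R) : Prop :=
  exists eps : nat -> R, eps @ \oo --> (0 : R) /\
  exists m0 : nat, forall m : nat, (m0 <= m)%N ->
  forall G : sgraph, num_edges G = m ->
    (1 + Num.sqrt (4 * m%:R - 3)) / 2 < rho R G ->
    (c - eps m) * m%:R ^+ 2 <= (num_C5 G)%:R.

(* Main.v *)
Require Import Defs.
From HB Require Import structures.
From mathcomp Require Import all_boot all_order all_algebra.
From mathcomp Require Import complex spectral sesquilinear ring lra zify.
From mathcomp Require Import all_classical all_reals all_analysis.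

Set Implicit Arguments.
Unset Strict Implicit.
Unset Printing Implicit Defensive.

Import Order.TTheory GRing.Theory Num.Theory numFieldNormedType.Exports.
Local Open Scope ring_scope.

(** Let [m] be the number of edges, [d] the degree and [rho] the spectral radius.
    Suppose that [G] has fewer than [(2/9) m^2] copies of [C5].  Degenerate closed
    5-walks number at most [5 \sum_v d(v) (A^3)_vv = O(m^2)], so [tr A^5 = O(m^2)].
    With [rho^2 - rho > m - 1] this forces the spectrum to consist of
    [sqrt m + O(1)], [- sqrt m + O(1)] and a rest whose squares sum to
    [O(sqrt m)].  Up to lower order terms, [tr A^3 >= 3 m], [tr A^4 >= 2 m^2] and
    [tr A^5 >= (5/3) m tr A^3]; the last bound says that there are at least
    [\sum_T (m - d(T)) - o(m^2)] copies of [C5], where [T] runs over the triangles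
    and [d(T)] is the sum of the degrees of the vertices of [T].

    The bound on [tr A^4] means that almost all pairs of edges span a 4-cycle.
    Hence either all degrees are below [m/6], and [d(T) <= m/2] for every [T], or
    there are [k] vertices of degree [m/k + o(m)] with almost the same
    neighbourhood and only [o(m)] edges avoid them.  For [k <> 2] the sum over
    triangles is at least [(2/9 - o(1)) m^2]; for [k = 3] the number of edges among the
    three large vertices decides how the triangles are distributed.  The same holds
    for [k = 2] if the large vertices are not adjacent.  If they are, [G] is close to
    a book, and a comparison of [rho^2 x] and [rho x] at the maximal entry of a Perron
    vector [x] gives [rho^2 - rho <= m - 1], a contradiction.

    The join of a path on three vertices with [s] isolated vertices has [3 s + 2]
    edges, at most [2 s^2] copies of [C5], and [rho] is a root of
    [x^3 - (3 s + 2) x - 4 s] above the threshold. *)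

(** * Spectrum of a real symmetric matrix *)

(** The complexified matrix is Hermitian, hence unitarily diagonalizable with a real diagonal [d].
    The last clause bounds the Euclidean operator norm; it holds because the diagonalizing matrix
    preserves norms. *)
Lemma spectral_real_symmetric (R : rcfType) (n : nat) (A : 'M[R]_n) :
  A^T = A -> exists d : 'I_n -> R,
  [/\ forall k, \tr (A ^+ k) = \sum_i d i ^+ k,
      forall z : R[i], eigenvalue (map_mx (real_complex R) A) z ->
        exists i, z = (d i)%:C%C,
      forall i, eigenvalue (map_mx (real_complex R) A) (d i)%:C%C &
      forall (r : R) (x : 'rV[R]_n), (forall i, `|d i| <= r) ->
        \sum_j (x *m A) 0 j ^+ 2 <= r ^+ 2 * \sum_j x 0 j ^+ 2].
Proof.
move=> symA; set B := map_mx _ A.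
have Bherm : B \is hermsymmx.
  apply: realsym_hermsym.
    apply/is_hermitianmxP; rewrite expr0 scale1r.
    by apply/matrixP => i j; rewrite !mxE -[in LHS]symA mxE.
  by apply/mxOverP => i j; rewrite mxE complex_real.
set P := spectralmx B; set D := spectral_diag B.
have BE : B = invmx P *m diag_mx D *m P.
  by apply/orthomx_spectralP/hermitian_normalmx.
have Pun : P \in unitmx by exact: spectral_unit.
have Puni : P \is unitarymx by exact: spectral_unitarymx.
have Dr i : D 0 i = (complex.Re (D 0 i))%:C%C.
  have /mxOverP/(_ 0 i) := hermitian_spectral_diag_real Bherm.
  by rewrite -/D => /complex_realP [k ->].
have Bdef : B = map_mx (real_complex R) A by [].
clearbody P D.
pose d i := complex.Re (D 0 i).
have Dd i : D 0 i = (d i)%:C%C := Dr i.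
have PB : P *m B = diag_mx D *m P by rewrite BE !mulmxA (mulmxV Pun) mul1mx.
exists d; split.
- move=> k; apply: (@fmorph_inj _ _ (real_complex R)).
  rewrite -(trace_map_mx (real_complex R)) rmorph_sum.
  have -> : map_mx (real_complex R) (A ^+ k) = B ^+ k by rewrite rmorphXn.
  have -> : B ^+ k = invmx P *m diag_mx (map_mx (fun z => z ^+ k) D) *m P.
    elim: k => [|k IH].
      rewrite expr0 (_ : map_mx _ D = const_mx 1); last first.
        by apply/rowP => i; rewrite !mxE expr0.
      by rewrite diag_const_mx mulmx1 mulVmx.
    have -> : B ^+ k.+1 = B *m B ^+ k by rewrite exprS.
    rewrite IH [X in X *m _]BE !mulmxA (mulmxK Pun) -(mulmxA (invmx P) (diag_mx D)) mulmx_diag.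
    apply: (congr1 (fun M => invmx P *m diag_mx M *m P)); apply/rowP => i.
    by rewrite !mxE exprS.
  rewrite -mulmxA mxtrace_mulC (mulmxK Pun) mxtrace_diag.
  by apply: eq_bigr => i _; rewrite mxE Dd rmorphXn.
- move=> z /eigenvalueP [v vB v0].
  have vP0 : v *m invmx P != 0.
    by apply: contra_neq v0 => /(congr1 (mulmx^~ P)); rewrite mulmxKV // mul0mx.
  have /rV0Pn [i wi] := vP0; exists i.
  have : (v *m invmx P) *m diag_mx D = z *: (v *m invmx P).
    by rewrite scalemxAl -vB BE !mulmxA mulmxK.
  move=> /rowP/(_ i); rewrite mul_mx_diag mxE [RHS]mxE mulrC => /(mulIf wi).
  by rewrite Dd.
- move=> i; apply/eigenvalueP; exists (row i P).
    by rewrite -row_mul PB row_mul row_diag_mx -scalemxAl -rowE Dd.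
  rewrite -[_ == _]/(row i P == 0); apply/negP => /eqP ri.
  have : row i (P *m invmx P) = 0 by rewrite row_mul ri mul0mx.
  rewrite mulmxV // => /rowP/(_ i); rewrite !mxE eqxx => /eqP.
  by rewrite oner_eq0.
- move=> r x hr; pose X := map_mx (real_complex R) x.
  pose Y := X *m invmx P.
  have nrm m (U : 'rV[R[i]]_m) : (U *m (U^t*)%sesqui) 0 0 = \sum_j `|U 0 j| ^+ 2.
    by rewrite mxE; apply: eq_bigr => j _; rewrite !mxE normCK.
  have uniP : invmx P = (P^t*)%sesqui by exact: invmx_unitary.
  have nrmP (U : 'rV[R[i]]_n) : \sum_j `|(U *m P) 0 j| ^+ 2 = \sum_j `|U 0 j| ^+ 2.
    by rewrite -!nrm trmx_mul map_mxM mulmxA -uniP mulmxK.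
  have nrmr (u : 'rV[R]_n) : (\sum_j u 0 j ^+ 2)%:C%C =
      \sum_j `|(map_mx (real_complex R) u) 0 j| ^+ 2.
    rewrite rmorph_sum; apply: eq_bigr => j _; rewrite mxE normc_def /= expr0n /= addr0.
    by rewrite sqrtr_sqr -rmorphXn /= real_normK // num_real.
  (* Nonnegativity of [r] comes from an index; for [n = 0] both sums are empty. *)
  have r0 : (exists i : 'I_n, true) -> 0 <= r by case=> i _; apply: le_trans (hr i).
  rewrite -lecR rmorphM nrmr [X in _ * X]nrmr map_mxM -/B -/X.
  have -> : X *m B = Y *m diag_mx D *m P by rewrite BE (mulmxA X) (mulmxA X).
  have XE : X = Y *m P by rewrite mulmxKV.
  rewrite nrmP [in leRHS]XE nrmP mulr_sumr; apply: ler_sum => i _.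
  rewrite mul_mx_diag mxE normrM exprMn mulrC ler_wpM2r ?exprn_ge0 //.
  rewrite Dd normc_def /= expr0n /= addr0 sqrtr_sqr -rmorphXn /= lecR.
  by rewrite ler_sqr ?nnegrE // (r0 (ex_intro _ i isT)).
Qed.

(** * Closed walks and the Perron vector *)

Section Graph.
Variables (R : realType) (G : sgraph).
Implicit Types a b c v : G.

Definition adjr a b : R := (adj a b)%:R.
Definition degr a : R := \sum_b adjr a b.
Definition tri a b c : R := adjr a b * adjr b c * adjr c a.
Definition walks3 : R := \sum_a \sum_b \sum_c tri a b c.
Definition walks4 : R :=
  \sum_a \sum_b \sum_c \sum_d adjr a b * adjr b c * adjr c d * adjr d a.
Definition walks5 : R :=
  \sum_a \sum_b \sum_c \sum_d \sum_e
    adjr a b * adjr b c * adjr c d * adjr d e * adjr e a.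

Lemma adjr_ge0 a b : 0 <= adjr a b. Proof. exact: ler0n. Qed.
Lemma adjr_le1 a b : adjr a b <= 1. Proof. by rewrite lern1 leq_b1. Qed.
Lemma adjrC a b : adjr a b = adjr b a. Proof. by rewrite /adjr adj_sym. Qed.
Lemma adjrr a : adjr a a = 0. Proof. by rewrite /adjr adj_irrefl. Qed.
Lemma adjr_sq a b : adjr a b * adjr a b = adjr a b.
Proof. by rewrite /adjr; case: adj; rewrite ?mulr1 ?mulr0. Qed.

Local Notation A := (adj_mx R G).

Lemma adj_mx_sym : A^T = A.
Proof. by apply/matrixP => i j; rewrite !mxE adj_sym. Qed.

Lemma sum_enum_val (V : nmodType) (F : G -> V) : \sum_(i < #|G|) F (enum_val i) = \sum_a F a.
Proof.
rewrite [RHS](reindex (enum_val (A := [pred _ : G | true]))) //=.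
by apply: onW_bij; apply: enum_val_bij.
Qed.

Lemma adj_mx_mulE (x : G -> R) j :
  (\row_i x (enum_val i) *m A) 0 j = \sum_b adjr (enum_val j) b * x b.
Proof.
rewrite mxE -sum_enum_val; apply: eq_bigr => i _.
by rewrite !mxE mulrC -/(adjr _ _) adjrC.
Qed.

Lemma trace_adj_mx2 : \tr (A ^+ 2) = \sum_a \sum_b adjr a b.
Proof.
rewrite expr2 -sum_enum_val; apply: eq_bigr => i _.
rewrite mxE -sum_enum_val; apply: eq_bigr => j _.
by rewrite !mxE (adj_sym (enum_val j)) adjr_sq.
Qed.

Lemma trace_adj_mx3 : \tr (A ^+ 3) = walks3.
Proof.
rewrite (_ : A ^+ 3 = A *m (A *m A)) // /walks3 -sum_enum_val.
apply: eq_bigr => i _.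
rewrite mxE -sum_enum_val; apply: eq_bigr => j _.
rewrite !mxE mulr_sumr -sum_enum_val; apply: eq_bigr => k _.
by rewrite !mxE /tri mulrA.
Qed.

Lemma trace_adj_mx4 : \tr (A ^+ 4) = walks4.
Proof.
rewrite (_ : A ^+ 4 = A *m (A *m (A *m A))) // /walks4 -sum_enum_val.
apply: eq_bigr => i _.
rewrite mxE -sum_enum_val; apply: eq_bigr => j _.
rewrite !mxE mulr_sumr -sum_enum_val; apply: eq_bigr => k _.
rewrite !mxE !mulr_sumr -sum_enum_val; apply: eq_bigr => l _.
by rewrite !mxE !mulrA.
Qed.

Lemma trace_adj_mx5 : \tr (A ^+ 5) = walks5.
Proof.
rewrite (_ : A ^+ 5 = A *m (A *m (A *m (A *m A)))) // /walks5 -sum_enum_val.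
apply: eq_bigr => i _.
rewrite mxE -sum_enum_val; apply: eq_bigr => j _.
rewrite !mxE mulr_sumr -sum_enum_val; apply: eq_bigr => k _.
rewrite !mxE !mulr_sumr -sum_enum_val; apply: eq_bigr => l _.
rewrite !mxE !mulr_sumr -sum_enum_val; apply: eq_bigr => q _.
by rewrite !mxE !mulrA.
Qed.

(** Perron-Frobenius for possibly disconnected graphs: the moduli [x] of an eigenvector for an
    eigenvalue of largest modulus satisfy [rho x <= A x] entrywise, and [A] increases norms at most
    by the factor [rho], so equality holds. Hence [rho] itself, not only [- rho], is an
    eigenvalue. *)
Lemma graph_spectrum : 0 < rho R G ->
  exists (n : nat) (d : 'I_n -> R) (i0 : 'I_n) (x : G -> R),
  [/\ d i0 = rho R G,
      [/\ \sum_i d i ^+ 2 = \sum_a \sum_b adjr a b,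
          \sum_i d i ^+ 3 = walks3,
          \sum_i d i ^+ 4 = walks4 &
          \sum_i d i ^+ 5 = walks5],
      (forall a, 0 <= x a), (exists a, 0 < x a) &
      forall a, rho R G * x a = \sum_b adjr a b * x b].
Proof.
have [d [dtr deig eigd dnorm]] := spectral_real_symmetric adj_mx_sym.
rewrite /rho /spectral_radius; set S := (X in sup X); move=> rgt0.
have normd i : ComplexField.Normc.normc (d i)%:C%C = `|d i|.
  by rewrite /= expr0n addr0 sqrtr_sqr.
have Sd i : S `|d i| by exists (d i)%:C%C; [exact: eigd | exact: normd].
have dS y : S y -> exists i, y = `|d i|.
  by case=> z /deig [i ->] <-; exists i.
(* The supremum of the empty set is 0 by default, so positivity of [rho] supplies an eigenvalue. *)
have [y0 Sy0] : (S !=set0)%classic.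
  apply/set0P/eqP => S0; move: rgt0; rewrite S0 sup0 ltxx //.
have [j0 _] := dS _ Sy0.
have [jm _ jmax] := @Order.TotalTheory.arg_maxP _ _ _ j0 xpredT (fun i => `|d i|) isT.
have {}jmax i : `|d i| <= `|d jm| by exact: jmax.
have supE : sup S = `|d jm|.
  have ub : ubound S `|d jm| by move=> y /dS [i ->]; exact: jmax.
  apply/le_anti/andP; split; first by apply: ge_sup => //; exists y0.
  by apply: ub_le_sup => //; exists `|d jm|.
have rE i : `|d i| <= sup S by rewrite supE jmax.
have /eigenvalueP [v vA v0] := eigd jm.
pose x a : R := ComplexField.Normc.normc (v 0 (enum_rank a)).
have xE i : x (enum_val i) = ComplexField.Normc.normc (v 0 i).
  by rewrite /x enum_valK.
have x0 a : 0 <= x a.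
  by rewrite -lecR; apply: (normr_ge0 (v 0 (enum_rank a))).
(* Triangle inequality in the eigenvector equation. *)
have subeig a : sup S * x a <= \sum_b adjr a b * x b.
  rewrite -[a]enum_rankK; set j := enum_rank a.
  rewrite supE -(normd jm) xE -ComplexField.Normc.normcM -lecR rmorph_sum.
  rewrite -[leLHS]/`|(d jm)%:C%C * v 0 j|.
  have -> : (d jm)%:C%C * v 0 j = \sum_i v 0 i * (A i j)%:C%C.
    have := congr1 (fun M : 'rV_ _ => M 0 j) vA; rewrite /= [RHS]mxE => <-.
    by rewrite mxE; apply: eq_bigr => i _; rewrite !mxE.
  apply: (le_trans (ler_norm_sum _ _ _)).
  rewrite -(sum_enum_val (fun b => (adjr (enum_val j) b * x b)%:C%C)).
  apply: ler_sum => i _.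
  rewrite !mxE normrM mulrC rmorphM xE /adjr adj_sym; apply: ler_pM => //.
  by case: adj; rewrite ?rmorph1 ?rmorph0 ?normr1 ?normr0.
have eig a : sup S * x a = \sum_b adjr a b * x b.
  have := dnorm (sup S) (\row_i x (enum_val i)) rE.
  under eq_bigr => j _ do rewrite adj_mx_mulE.
  rewrite (sum_enum_val (fun a => (\sum_b adjr a b * x b) ^+ 2)).
  under [X in _ <= _ * X]eq_bigr => j _ do rewrite mxE.
  rewrite (sum_enum_val (fun a => x a ^+ 2)) mulr_sumr => le_sq.
  have ge_sq b : (sup S * x b) ^+ 2 <= (\sum_c adjr b c * x c) ^+ 2.
    by rewrite ler_sqr ?nnegrE ?subeig ?mulr_ge0 ?(ltW rgt0) ?sumr_ge0 // => c _;
      rewrite mulr_ge0 ?adjr_ge0.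
  apply/eqP; rewrite -(eqrXn2 (n := 2)) ?mulr_ge0 ?(ltW rgt0) ?sumr_ge0 //; last first.
    by move=> c _; rewrite mulr_ge0 ?adjr_ge0.
  rewrite eq_sym -subr_eq0; apply/eqP.
  (* Each difference is nonnegative, and the norm bound makes their sum at most 0. *)
  have sum0 : \sum_b ((\sum_c adjr b c * x c) ^+ 2 - (sup S * x b) ^+ 2) = 0.
    apply/le_anti; rewrite sumr_ge0 ?andbT; last by move=> b _; rewrite subr_ge0.
    rewrite sumrB subr_le0; apply: (le_trans le_sq).
    by apply: ler_sum => b _; rewrite exprMn.
  apply: (psumr_eq0P _ sum0) => // b _; by rewrite subr_ge0.
have [i0 i0E] : exists i, (sup S)%:C%C = (d i)%:C%C.
  apply: deig; apply/eigenvalueP.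
  exists (map_mx (real_complex R) (\row_i x (enum_val i))).
    rewrite -map_mxM; apply/rowP => j; rewrite !mxE -rmorphM eig; congr (_%:C)%C.
    by rewrite -adj_mx_mulE mxE.
  have /rV0Pn [i vi] := v0; apply/rV0Pn; exists i; rewrite !mxE xE.
  by rewrite -[_%:C%C]/`|v 0 i| normr_eq0.
exists #|G|, d, i0, x; split => //.
- by case: i0E.
- by rewrite -!dtr trace_adj_mx2 trace_adj_mx3 trace_adj_mx4 trace_adj_mx5.
- have /rV0Pn [i vi] := v0; exists (enum_val i); rewrite xE -ltcR.
  by rewrite -[X in _ < X]/`|v 0 i| normr_gt0.
Qed.

End Graph.

(** * Moments of the spectrum *)

(* The fifth moment is at least [rho^5 - nu^3 * sum d_i^2], so [nu] cannot be
   much below [s]; what the second moment leaves to the rest is [O(s)]. *)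
Lemma second_eigenvalue (R : realFieldType) (n : nat) (d : 'I_n -> R) (i0 : 'I_n)
    (s C : R) :
  1 <= C -> 2 * C <= s -> 0 < d i0 -> s ^+ 2 - 1 < d i0 ^+ 2 - d i0 ->
  \sum_i d i ^+ 2 = 2 * s ^+ 2 -> \sum_i d i ^+ 5 <= C * s ^+ 4 ->
  exists j, [/\ j != i0,
    s <= d i0 <= s + C /\ s ^+ 2 + s - 1 <= d i0 ^+ 2,
    s - C <= - d j, d j ^+ 2 <= 2 * s ^+ 2 - d i0 ^+ 2 &
    \sum_(i | (i != i0) && (i != j)) d i ^+ 2 <= 2 * C * s].
Proof.
move=> C1 Cs r0 hr sq2 sum5; set r := d i0 in r0 hr *.
have rs : s <= r.
  rewrite leNgt; apply/negP => rs.
  have : 0 <= (s - r) * (s + r - 1) by apply: mulr_ge0; lra.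
  by lra.
have r2 : s ^+ 2 + s - 1 <= r ^+ 2 by lra.
have rest2 : \sum_(i | i != i0) d i ^+ 2 = 2 * s ^+ 2 - r ^+ 2.
  by move: sq2; rewrite (bigD1 i0) //= -/r; lra.
have rest5 : \sum_(i | i != i0) d i ^+ 5 <= C * s ^+ 4 - r ^+ 5.
  by move: sum5; rewrite (bigD1 i0) //= -/r; lra.
have r5 : s ^+ 5 <= r ^+ 5 by rewrite lerXn2r ?nnegrE //; lra.
have neg5 : C * s ^+ 4 - r ^+ 5 < 0.
  rewrite subr_lt0; apply: lt_le_trans r5; rewrite (exprS s 4) ltr_pM2r; first by lra.
  by apply: exprn_gt0; lra.
have [k ki0 dk] : exists2 k, k != i0 & d k < 0.
  apply/not_exists2P => H; have : 0 <= \sum_(i | i != i0) d i ^+ 5.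
    by apply: sumr_ge0 => i ii0; have [//|/negP] := H i; rewrite -leNgt => /exprn_ge0.
  by lra.
have [j ji0 jmin0] := @Order.TotalTheory.arg_minP _ _ _ k [pred i | i != i0] d ki0.
have jmin i : i != i0 -> d j <= d i by exact: jmin0.
have dj : d j < 0 by apply: le_lt_trans dk; exact: jmin.
set v := - d j; have v0 : 0 < v by rewrite oppr_gt0.
(* As [d i >= - v], also [d i ^+ 3 >= - v ^+ 3], by factoring the sum of two cubes. *)
have term i : i != i0 -> - v ^+ 3 * d i ^+ 2 <= d i ^+ 5.
  move=> /jmin; rewrite -[d j]opprK -/v => vi.
  rewrite (_ : 5 = 3 + 2)%N // exprD ler_wpM2r ?sqr_ge0 // -subr_ge0 opprK.
  rewrite (_ : _ + _ = (d i + v) * ((d i - v / 2) ^+ 2 + 3 / 4 * v ^+ 2)); last by field.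
  apply: mulr_ge0; first by lra.
  by rewrite addr_ge0 ?sqr_ge0 // mulr_ge0 ?sqr_ge0 //; lra.
have v3 : r ^+ 5 - C * s ^+ 4 <= v ^+ 3 * (2 * s ^+ 2 - r ^+ 2).
  have : - v ^+ 3 * (2 * s ^+ 2 - r ^+ 2) <= \sum_(i | i != i0) d i ^+ 5.
    by rewrite -rest2 mulr_sumr; apply: ler_sum.
  by lra.
(* From [r^5 >= s^5] and [2 s^2 - r^2 <= s^2], after division by [s^2]. *)
have v3' : s ^+ 3 - C * s ^+ 2 <= v ^+ 3.
  rewrite -(ler_pM2r (x := s ^+ 2)); last by rewrite exprn_gt0 //; lra.
  have : v ^+ 3 * (2 * s ^+ 2 - r ^+ 2) <= v ^+ 3 * s ^+ 2.
    by rewrite ler_pM2l ?exprn_gt0 //; nra.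
  by rewrite mulrBl -mulrA -!exprD; lra.
have vs : s - C <= v.
  rewrite leNgt; apply/negP => vs.
  have : v ^+ 3 < (s - C) ^+ 3 by rewrite ltrXn2r //; lra.
  have : (s - C) ^+ 3 <= s ^+ 3 - C * s ^+ 2.
    have : 0 <= C * (2 * s * (s - 2 * C) + C * s - C ^+ 2) by apply: mulr_ge0; nra.
    by nra.
  by lra.
have splitj : \sum_(i | i != i0) d i ^+ 2 =
    d j ^+ 2 + \sum_(i | (i != i0) && (i != j)) d i ^+ 2 by rewrite (bigD1 j).
have rest0 : 0 <= \sum_(i | (i != i0) && (i != j)) d i ^+ 2.
  by apply: sumr_ge0 => i _; exact: sqr_ge0.
have dj2 : d j ^+ 2 = v ^+ 2 by rewrite sqrrN.
have v2 : (s - C) ^+ 2 <= v ^+ 2 by rewrite lerXn2r ?nnegrE //; lra.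
exists j; split => //; first by split=> //; rewrite rs /=; nra.
- by lra.
- by nra.
Qed.

(** Meant for the eigenvalues other than the two extreme ones: all are small and their squares have
    a small sum, so their higher moments are negligible. *)
Lemma ler_sum_norm_exp (R : realFieldType) (I : finType) (P : pred I) (d : I -> R)
    (w S : R) (k : nat) :
  0 <= w -> (forall i, P i -> `|d i| <= w) -> \sum_(i | P i) d i ^+ 2 <= S ->
  `|\sum_(i | P i) d i ^+ (2 + k)| <= w ^+ k * S.
Proof.
move=> w0 dw dS; apply: (le_trans (ler_norm_sum _ _ _)).
apply: (@le_trans _ _ (w ^+ k * \sum_(i | P i) d i ^+ 2)); last first.
  by rewrite ler_wpM2l ?exprn_ge0.
rewrite mulr_sumr; apply: ler_sum => i Pi.
rewrite normrX exprD mulrC real_normK ?num_real // ler_wpM2r ?sqr_ge0 //.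
by rewrite lerXn2r ?nnegrE ?dw.
Qed.

(** From [r^2 - v^2 >= 2 (r^2 - s^2) >= 2 (s - 1)] and [r + v <= 2 s] one gets [r - v >= 1 - 1/s],
    while [r^2 + r v + v^2] is about [3 s^2]. This asymmetry of the extreme eigenvalues is the
    source of the [3 m] closed 3-walks. *)
Lemma cube_diff_ge (R : realFieldType) (s C r v : R) :
  1 <= C -> 2 * C <= s -> s <= r -> s - C <= v ->
  s ^+ 2 + s - 1 <= r ^+ 2 -> r ^+ 2 + v ^+ 2 <= 2 * s ^+ 2 ->
  3 * s ^+ 2 - 6 * C * s <= r ^+ 3 - v ^+ 3.
Proof.
move=> C1 Cs rs vs r2 rv2.
have s0 : 0 < s by lra.
have sC0 : 0 < s - C by lra.
have v0 : 0 < v by exact: lt_le_trans vs.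
have r0 : 0 < r by exact: lt_le_trans rs.
have rv : r + v <= 2 * s.
  have q2 : (r + v) ^+ 2 <= (2 * s) ^+ 2.
    by have := sqr_ge0 (r - v); lra.
  by move: q2; rewrite ler_sqr ?nnegrE //; lra.
have vr : v <= r.
  by rewrite -ler_sqr ?nnegrE //; lra.
have rmv : s - 1 <= (r - v) * s.
  have : (r - v) * (r + v) <= (r - v) * (2 * s) by rewrite ler_wpM2l ?subr_ge0.
  by lra.
have q0 : s * (3 * s - 3 * C) <= r ^+ 2 + r * v + v ^+ 2.
  have a1 : s * (s - C) <= r * v by apply: ler_pM; lra.
  have a2 : (s - C) ^+ 2 <= v ^+ 2 by apply: lerXn2r; rewrite ?nnegrE; lra.
  have a3 : s ^+ 2 <= r ^+ 2 by apply: lerXn2r; rewrite ?nnegrE; lra.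
  by have := sqr_ge0 C; lra.
have q1 : (s - 1) * (3 * s - 3 * C) <= (r - v) * (r ^+ 2 + r * v + v ^+ 2).
  apply: (@le_trans _ _ ((r - v) * (s * (3 * s - 3 * C)))).
    by rewrite mulrA ler_wpM2r //; lra.
  by rewrite ler_wpM2l ?subr_ge0.
have Cs1 : s <= C * s by rewrite ler_peMl // ltW.
have -> : r ^+ 3 - v ^+ 3 = (r - v) * (r ^+ 2 + r * v + v ^+ 2) by ring.
by lra.
Qed.

Lemma cube_diff_le (R : realFieldType) (s C r v : R) :
  1 <= C -> 2 * C <= s -> s <= r -> s - C <= v ->
  r <= s + C -> r ^+ 3 - v ^+ 3 <= 8 * C * s ^+ 2.
Proof.
move=> C1 Cs rs vs rsC.
have s0 : 0 < s by lra.
have sC0 : 0 < s - C by lra.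
have v0 : 0 < v by exact: lt_le_trans vs.
have r0 : 0 < r by exact: lt_le_trans rs.
have a1 : r ^+ 3 <= (s + C) ^+ 3.
  by apply: lerXn2r; rewrite ?nnegrE; lra.
have a2 : (s - C) ^+ 3 <= v ^+ 3 by apply: lerXn2r; rewrite ?nnegrE; lra.
have a3 : C ^+ 3 <= C * s ^+ 2.
  by rewrite exprS ler_pM2l; [apply: lerXn2r; rewrite ?nnegrE; lra | lra].
rewrite (_ : 8 * C * s ^+ 2 = (s + C) ^+ 3 - (s - C) ^+ 3 + 2 * (C * s ^+ 2 - C ^+ 3));
  last by ring.
by lra.
Qed.

Lemma fourth_sum_ge (R : realFieldType) (s C r v : R) :
  1 <= C -> 2 * C <= s -> s <= r -> s - C <= v ->
  2 * s ^+ 4 - 4 * C * s ^+ 3 <= r ^+ 4 + v ^+ 4.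
Proof.
move=> C1 Cs rs vs.
have s0 : 0 < s by lra.
have sC0 : 0 < s - C by lra.
have v0 : 0 < v by exact: lt_le_trans vs.
have r0 : 0 < r by exact: lt_le_trans rs.
have a1 : s ^+ 4 <= r ^+ 4 by apply: lerXn2r; rewrite ?nnegrE; lra.
have a2 : (s - C) ^+ 4 <= v ^+ 4 by apply: lerXn2r; rewrite ?nnegrE; lra.
have a3 : 0 <= C ^+ 2 * (2 * s ^+ 2 + 4 * s * (s - C) + C ^+ 2).
  by rewrite mulr_ge0 ?sqr_ge0 // !addr_ge0 ?sqr_ge0 ?mulr_ge0 ?sqr_ge0; lra.
have e : (s - C) ^+ 4 = s ^+ 4 - 4 * C * s ^+ 3 +
  C ^+ 2 * (2 * s ^+ 2 + 4 * s * (s - C) + C ^+ 2) by ring.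
by lra.
Qed.

(* [x^5 - (5/3) s^2 x^3] has a critical point at [s], so errors of order [O(1)]
   in the two extreme eigenvalues only contribute to second order. *)
Lemma quintic_diff_ge (R : realFieldType) (s C r v : R) :
  1 <= C -> 2 * C <= s -> s <= r -> s - C <= v ->
  v <= s ->
  - (5 * C ^+ 2 * s ^+ 3) <=
  (r ^+ 5 - 5 / 3 * s ^+ 2 * r ^+ 3) - (v ^+ 5 - 5 / 3 * s ^+ 2 * v ^+ 3).
Proof.
move=> C1 Cs rs vs vss.
have s0 : 0 < s by lra.
have sC0 : 0 < s - C by lra.
have v0 : 0 < v by exact: lt_le_trans vs.
have r0 : 0 < r by exact: lt_le_trans rs.
(* The cofactor of the double root at [s] of [x^5 - (5/3) s^2 x^3 + (2/3) s^5]. *)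
pose q x := x ^+ 3 + 2 * s * x ^+ 2 + 4 / 3 * s ^+ 2 * x + 2 / 3 * s ^+ 3.
have q0 x : 0 < x -> 0 <= q x.
  by move=> x0; rewrite !addr_ge0 ?mulr_ge0 ?exprn_ge0 ?divr_ge0 ?(ltW x0) ?(ltW s0).
have qs : q v <= 5 * s ^+ 3.
  have a1 : v ^+ 3 <= s ^+ 3 by apply: lerXn2r; rewrite ?nnegrE; lra.
  have a2 : s * v ^+ 2 <= s ^+ 3.
    by rewrite (exprS s 2) ler_pM2l //; apply: lerXn2r; rewrite ?nnegrE; lra.
  have a3 : s ^+ 2 * v <= s ^+ 3 by rewrite (exprSr s 2) ler_pM2l ?exprn_gt0.
  by rewrite /q; lra.
have gE x : x ^+ 5 - 5 / 3 * s ^+ 2 * x ^+ 3 = (x - s) ^+ 2 * q x - 2 / 3 * s ^+ 5.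
  by rewrite /q; field.
have gr : 0 <= (r - s) ^+ 2 * q r by rewrite mulr_ge0 ?sqr_ge0 ?q0.
have gv : (v - s) ^+ 2 * q v <= C ^+ 2 * (5 * s ^+ 3).
  apply: ler_pM; rewrite ?sqr_ge0 ?q0 //.
  by rewrite -(sqrrN (v - s)) opprB; apply: lerXn2r; rewrite ?nnegrE; lra.
by rewrite !gE; lra.
Qed.

(** Applied with [s^2 = m] and [h] as relative error. The main terms come from the extreme
    eigenvalues [r] and [- v]; the others have modulus at most [k s] with [k] small. *)
Lemma moment_estimates (R : realFieldType) (n : nat) (d : 'I_n -> R) (i0 : 'I_n)
    (s C h : R) :
  1 <= C -> 0 < h <= 1 -> 300 * C ^+ 3 <= s * h ^+ 2 ->
  0 < d i0 -> s ^+ 2 - 1 < d i0 ^+ 2 - d i0 ->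
  \sum_i d i ^+ 2 = 2 * s ^+ 2 -> \sum_i d i ^+ 5 <= C * s ^+ 4 ->
  [/\ (3 - h) * s ^+ 2 <= \sum_i d i ^+ 3,
      \sum_i d i ^+ 3 <= 9 * C * s ^+ 2,
      (2 - h) * s ^+ 4 <= \sum_i d i ^+ 4 &
      5 / 3 * s ^+ 2 * \sum_i d i ^+ 3 - h * s ^+ 4 <= \sum_i d i ^+ 5].
Proof.
move=> C1 /andP[h0 h1] hs1 r0 hr sq2 sum5.
have C2 : 1 <= C ^+ 2 by rewrite exprn_ege1.
have CC : C <= C ^+ 3 by rewrite exprS ler_peMr //; move: C1; clear; lra.
have h2 : 0 < h ^+ 2 by rewrite exprn_gt0.
have s0 : 0 < s.
  by rewrite -(pmulr_lgt0 _ h2); move: C1 CC hs1; clear; lra.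
have hs2 : 300 * C <= s * h.
  have : s * h ^+ 2 <= s * h by rewrite ler_pM2l // expr2 ler_piMl // ltW.
  by move: CC hs1; clear; lra.
have hs3 : 300 * C <= s by have : s * h <= s; [rewrite ler_piMr // ltW | lra].
have Cs : 2 * C <= s by move: C1 hs3; clear; lra.
have [j [ji0 [/andP[rs rsC] r2] vs v2 rest2]] :=
  second_eigenvalue C1 Cs r0 hr sq2 sum5.
set r := d i0 in r0 hr rs rsC r2 v2 *.
set v := - d j in vs *.
have dj : d j = - v by rewrite opprK.
rewrite dj sqrrN in v2.
(* With this [k], [(k s)^2] exceeds the bound [2 C s] on the remaining squares, and the remaining
   cubes sum to at most [k s * 2 C s = (h / 6) s^2]. *)
pose k := h / (12 * C).
have kC : k * C = h / 12 by rewrite /k; field; move: C1; clear; lra.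
have k0 : 0 <= k by rewrite divr_ge0 ?(ltW h0) //; move: C1; clear; lra.
have k1 : k <= 1.
  by have : k <= k * C; [rewrite ler_peMr | move: kC h1; clear; lra].
have ks2 : 2 * C * s <= (k * s) ^+ 2.
  have : 2 * C ^+ 3 <= (k * C) ^+ 2 * s by rewrite kC; move: hs1 C1 CC; clear; lra.
  rewrite -(ler_pM2r s0) => base.
  rewrite -(ler_pM2r (x := C ^+ 2)); last by move: C2; clear; lra.
  rewrite (_ : 2 * C * s * _ = 2 * C ^+ 3 * s); last by ring.
  by rewrite (_ : (k * s) ^+ 2 * _ = (k * C) ^+ 2 * s * s) //; ring.
pose P i := (i != i0) && (i != j).
have ks0 : 0 <= k * s by rewrite mulr_ge0 // ltW.
have dk i : P i -> `|d i| <= k * s.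
  move=> Pi.
  rewrite -(ler_sqr _ ks0) ?nnegrE // real_normK ?num_real //; apply: le_trans ks2.
  apply: le_trans rest2; rewrite (bigD1 i) //= lerDl sumr_ge0 // => l _.
  exact: sqr_ge0.
have split3 e : \sum_i d i ^+ e = r ^+ e + (- v) ^+ e + \sum_(i | P i) d i ^+ e.
  by rewrite (bigD1 i0) //= (bigD1 j) //= dj addrA.
have e3 : (k * s) ^+ 1 * (2 * C * s) = h / 6 * s ^+ 2.
  by rewrite expr1 (_ : _ * _ = 2 * (k * C) * s ^+ 2); [rewrite kC; field | ring].
have e5 : (k * s) ^+ 3 * (2 * C * s) <= h / 6 * s ^+ 4.
  rewrite (_ : _ * _ = k ^+ 2 * (2 * (k * C) * s ^+ 4)); last by ring.
  rewrite kC (_ : 2 * (h / 12) = h / 6); last by field.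
  apply: ler_piMl; last exact: exprn_ile1.
  by rewrite mulr_ge0 ?exprn_ge0 ?divr_ge0 // ltW.
have := ler_sum_norm_exp 1 ks0 dk rest2; rewrite ler_norml e3 => /andP[l3 u3].
have := ler_sum_norm_exp 3 ks0 dk rest2; rewrite ler_norml => /andP[l5 _].
have {l5 e5} l5 : - (h / 6 * s ^+ 4) <= \sum_(i | P i) d i ^+ 5.
  by apply: le_trans l5; rewrite lerN2.
have s2 : 0 < s ^+ 2 by rewrite exprn_gt0.
have s3h : 300 * C * s ^+ 3 <= h * s ^+ 4.
  by rewrite (exprS s 3) mulrA ler_pM2r ?exprn_gt0 // [h * s]mulrC.
have s2h : 300 * C * s <= h * s ^+ 2 by rewrite expr2 mulrA ler_pM2r // [h * s]mulrC.
have v0 : 0 < v by move: vs hs3 C1; clear; lra.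
have vss : v <= s.
  by rewrite -ler_sqr ?nnegrE ?(ltW s0) ?(ltW v0) //; move: v2 r2 hs3 C1; clear; lra.
have rv2 : r ^+ 2 + v ^+ 2 <= 2 * s ^+ 2 by move: v2; clear; lra.
have eN3 : (- v) ^+ 3 = - v ^+ 3 by ring.
have eN5 : (- v) ^+ 5 = - v ^+ 5 by ring.
have eN4 : (- v) ^+ 4 = v ^+ 4 by ring.
split; rewrite !split3 ?eN3 ?eN4 ?eN5.
- have := cube_diff_ge C1 Cs rs vs r2 rv2.
  have : 0 <= h * s ^+ 2 by rewrite mulr_ge0 ?(ltW h0) ?(ltW s2).
  by move: l3 s2h; clear; set S := \sum_(i | P i) _; lra.
- have := cube_diff_le C1 Cs rs vs rsC.
  have : s ^+ 2 <= C * s ^+ 2 by rewrite ler_peMl // ltW.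
  have : h * s ^+ 2 <= s ^+ 2 by rewrite ler_piMl // ltW.
  by move: u3 s2; clear; set S := \sum_(i | P i) _; lra.
- have := fourth_sum_ge C1 Cs rs vs.
  have : 0 <= \sum_(i | P i) d i ^+ 4.
    by apply: sumr_ge0 => i _; rewrite exprn_even_ge0.
  have : 0 <= C * s ^+ 3 by rewrite mulr_ge0 ?exprn_ge0 ?(ltW s0) //; move: C1; clear; lra.
  by move: s3h; clear; set S := \sum_(i | P i) _; lra.
- have := quintic_diff_ge C1 Cs rs vs vss.
  have C2s : C ^+ 2 * s ^+ 3 <= C ^+ 3 * s ^+ 3.
    rewrite ler_pM2r ?exprn_gt0 // (exprS C 2) ler_peMl ?sqr_ge0 //.
  have hs4 : 300 * C ^+ 3 * s ^+ 3 <= h * s ^+ 4.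
    rewrite (exprS s 3) (mulrA h) ler_pM2r ?exprn_gt0 //; apply: (le_trans hs1).
    by rewrite expr2 mulrA [h * s]mulrC ler_piMr // mulr_ge0 ?ltW.
  have : 0 <= C ^+ 3 * s ^+ 3.
    by rewrite mulr_ge0 ?exprn_ge0 ?(ltW s0) //; move: C1; clear; lra.
  have : s ^+ 2 * \sum_(i | P i) d i ^+ 3 <= h / 6 * s ^+ 4.
    rewrite (_ : h / 6 * s ^+ 4 = s ^+ 2 * (h / 6 * s ^+ 2)); last by ring.
    by rewrite ler_pM2l.
  move: l5 C2s hs4; clear.
  set S := \sum_(i | P i) d i ^+ 3; set T := \sum_(i | P i) d i ^+ 5; lra.
Qed.

(** * Copies of C5 and closed walks *)

Lemma set2_eq (T : finType) (a b c d : T) :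
  [set a; b]%SET = [set c; d]%SET -> (a = c /\ b = d) \/ (a = d /\ b = c).
Proof.
move=> /setP E; have := E a; have := E b; have := E c; have := E d.
rewrite !inE !eqxx !orbT /= => hd hc /esym hb /esym ha.
case/orP: ha => /eqP ea; [left|right]; split=> //.
- by case/orP: hb => /eqP eb //; case/orP: hd => /eqP ->; rewrite ?ea ?eb.
- by case/orP: hb => /eqP eb //; case/orP: hc => /eqP ->; rewrite ?ea ?eb.
Qed.

Lemma card_darts (G : sgraph) :
  #|[set p : G * G | adj p.1 p.2]%SET| = (2 * num_edges G)%N.
Proof.
rewrite -sum1_card (partition_big (fun p => [set p.1; p.2]%SET) (mem (edges G))) /=;
  last by move=> p; rewrite inE => adjp; apply/imsetP; exists p; rewrite ?inE.
rewrite mulnC /num_edges -sum_nat_const; apply: eq_bigr => e /imsetP [[a b]] /=.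
rewrite inE /= => adjab ->.
have ab : a != b by apply: contraTneq adjab => ->; rewrite adj_irrefl.
rewrite (eq_bigl (mem [set (a, b); (b, a)]%SET)) => [|[c d]].
  by rewrite sum1_card cards2 xpair_eqE negb_and ab.
rewrite !inE /=; apply/andP/orP => [[adjcd /eqP /set2_eq [] [-> ->]]|].
- by left.
- by right.
- by case=> /eqP [-> ->]; rewrite ?(adj_sym b) adjab // finset.setUC eqxx.
Qed.

Lemma sum_adjr (R : realType) (G : sgraph) :
  \sum_(a : G) \sum_(b : G) adjr R a b = 2 * (num_edges G)%:R.
Proof.
rewrite -natrM -card_darts -sum1_card natr_sum pair_bigA [RHS]big_mkcond /=.
by apply: eq_bigr => -[a b] _; rewrite inE /= /adjr; case: adj.
Qed.

Lemma C5_adj_third (x y z z' : C5) :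
  C5_adj x y -> C5_adj y z -> C5_adj y z' -> z != x -> z' != x -> z = z'.
Proof.
have SI := @ordS_inj 5.
move=> /orP[] /eqP e /orP[] /eqP ez /orP[] /eqP ez' nz nz'.
- by rewrite ez ez'.
- by move: nz'; rewrite (SI z' x) ?eqxx // -e -ez'.
- by move: nz; rewrite (SI z x) ?eqxx // -e -ez.
- by move: nz; rewrite (SI z x) ?eqxx // -e -ez.
- by move: nz; rewrite ez e eqxx.
- by move: nz; rewrite ez e eqxx.
- by move: nz'; rewrite ez' e eqxx.
- by apply: SI; rewrite -ez.
Qed.

Lemma C5_cover (i : 'I_5) :
  [|| i == ord0, i == ordS ord0, i == ordS (ordS ord0),
      i == ordS (ordS (ordS ord0)) | i == ordS (ordS (ordS (ordS ord0)))].
Proof. by case: i => [[|[|[|[|[|i]]]]] hi]; rewrite -!val_eqE. Qed.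

(** Two consecutive values determine the next: it is the neighbour of the second that differs from
    the first. *)
Lemma C5_hom_eq (h h' : 'I_5 -> 'I_5) :
  injective h -> injective h' ->
  (forall i, C5_adj (h i) (h (ordS i))) -> (forall i, C5_adj (h' i) (h' (ordS i))) ->
  h ord0 = h' ord0 -> h (ordS ord0) = h' (ordS ord0) -> h =1 h'.
Proof.
move=> hI hI' hA hA' e0 e1.
have SS i : ordS (ordS i) != i :> 'I_5 by case: i => [[|[|[|[|[|i]]]]] hi].
have step (i : 'I_5) : h i = h' i -> h (ordS i) = h' (ordS i) ->
    h (ordS (ordS i)) = h' (ordS (ordS i)).
  move=> ei eS; apply: (C5_adj_third (hA i) (hA (ordS i))).
  - by rewrite eS; exact: hA'.
  - by rewrite (inj_eq hI); exact: SS.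
  - by rewrite ei (inj_eq hI'); exact: SS.
have e2 := step _ e0 e1; have e3 := step _ e1 e2; have e4 := step _ e2 e3.
by move=> i; case/or4P: (C5_cover i) => [/eqP->|/eqP->|/eqP->|/orP[/eqP->|/eqP->]].
Qed.

Section Copies.
Variable G : sgraph.

Definition C5_homs : {set {ffun 'I_5 -> G}} :=
  [set f : {ffun 'I_5 -> G} |
     injectiveb f && [forall i, adj (f i) (f (ordS i))]]%SET.

Definition C5_image (f : {ffun 'I_5 -> G}) : {set G} * {set {set G}} :=
  ([set f x | x : C5], [set [set f x | x in A] | A : {set C5} in edges C5])%SET.

Lemma C5_image_copies f : f \in C5_homs -> C5_image f \in copies C5 G.
Proof.
rewrite inE => /andP[fI /forallP fA]; rewrite inE; apply/andP; split; last first.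
  by apply/existsP; exists f; rewrite fI !eqxx.
apply/fintype.subsetP => B /imsetP [A /imsetP [[p q]]]; rewrite inE /= => pq -> ->.
rewrite imsetU1 imset_set1; apply/imsetP; exists (f p, f q) => //; rewrite inE /=.
by case/orP: pq => /eqP ->; rewrite // adj_sym.
Qed.

(** Fix a parametrization [f0] of a copy. Every other one is [f0] composed with an automorphism of
    the 5-cycle, which is determined by the dart formed by its first two values, and there are ten
    darts. *)
Lemma card_C5_homs_le : (#|C5_homs| <= 10 * num_C5 G)%N.
Proof.
rewrite -sum1_card (partition_big C5_image (mem (copies C5 G))) /=;
  last exact: C5_image_copies.
rewrite mulnC /num_C5 -sum_nat_const; apply: leq_sum => S _.
rewrite sum1_card; set F := (X in #|X|).
have [f0 Ff0|F0] := pickP F; last by rewrite (eq_card F0) card0.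
(* [h g] is [g] followed by the inverse of [f0]; the default [ord0] is never reached for [g] in
   [F]. *)
pose h (g : {ffun 'I_5 -> G}) i := odflt ord0 [pick j | f0 j == g i].
have /andP[] := Ff0; rewrite inE => /andP[/injectiveP f0I f0A] /eqP f0S.
have hE g i : g \in F -> f0 (h g i) = g i.
  move=> /andP[_ /eqP gS].
  have : g i \in S.1 by rewrite -gS /=; apply: imset_f.
  rewrite -f0S /= => /imsetP [j _ ej]; rewrite /h; case: pickP => [k /eqP //|].
  by move=> /(_ j); rewrite ej eqxx.
have hI g : g \in F -> injective (h g).
  move=> gF i j /(congr1 f0); rewrite !hE //.
  by case/andP: gF; rewrite inE => /andP[/injectiveP gI _] _; exact: gI.
have hA g : g \in F -> forall i, C5_adj (h g i) (h g (ordS i)).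
  move=> gF i; have /andP[_ /eqP gS] := gF.
  have : [set g i; g (ordS i)]%SET \in S.2.
    rewrite -gS /=; apply/imsetP; exists [set i; ordS i]%SET.
      by apply/imsetP; exists (i, ordS i) => //; rewrite inE /= /C5_adj eqxx.
    by rewrite imsetU1 imset_set1.
  rewrite -f0S /= => /imsetP [A /imsetP [[p q]]]; rewrite inE /= => pq ->.
  rewrite imsetU1 imset_set1 -!(hE g) // => /set2_eq [] [/f0I -> /f0I ->] //.
  by rewrite C5_adj_sym.
have card10 : #|[set p : C5 * C5 | adj p.1 p.2]%SET| = 10%N.
  rewrite (_ : [set _ | _]%SET = [set (i, ordS i) | i : 'I_5]%SET :|:
    [set (ordS i, i) | i : 'I_5]%SET).
    rewrite cardsU !card_imset ?card_ord; [|by move=> i j [_]|by move=> i j []].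
    rewrite (_ : _ :&: _ = finset.set0) ?cards0 //; apply/setP => -[i j].
    rewrite !inE; apply/negP => /andP[/imsetP[k _ [-> ->]] /imsetP[l _ [-> e]]].
    by have := e; case: l {e} => [[|[|[|[|[|l]]]]] hl] // /(congr1 val).
  apply/setP => -[i j]; rewrite !inE /= /C5_adj; apply/orP/orP.
    by case=> /eqP ->; [left|right]; apply: imset_f.
  by case=> /imsetP [k _ [-> ->]]; rewrite eqxx; [left|right].
rewrite -card10 -(@card_in_imset _ _ (fun g => (h g ord0, h g (ordS ord0))) F).
  by apply: subset_leq_card; apply/fintype.subsetP => p /imsetP [g gF ->]; rewrite inE /= hA.
move=> g g' gF gF' [e0 e1]; apply/ffunP => i; rewrite -(hE g i gF) -(hE g' i gF'); congr (f0 _).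
by apply: C5_hom_eq => //; [exact: hI|exact: hI|exact: hA|exact: hA].
Qed.

End Copies.

Lemma sum_eqb (R : pzRingType) (I : finType) (a : I) (F : I -> R) :
  \sum_b (a == b)%:R * F b = F a.
Proof.
rewrite (bigD1 a) //= eqxx mul1r big1 ?addr0 // => b ba.
by rewrite eq_sym (negPf ba) mul0r.
Qed.

(** * Closed 5-walks with and without repeated vertices *)

Section ClosedWalks.
Variables (R : realType) (G : sgraph).
Local Notation al := (@adjr R G).
Local Notation dg := (@degr R G).

Definition closed3 (a : G) : R := \sum_b \sum_c tri R a b c.

Definition walk5 (a b c d e : G) : R := al a b * al b c * al c d * al d e * al e a.

Lemma walk5_rot a b c d e : walk5 a b c d e = walk5 b c d e a.
Proof. by rewrite /walk5; ring. Qed.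

Lemma walk5_ge0 a b c d e : 0 <= walk5 a b c d e.
Proof. by rewrite !mulr_ge0 ?adjr_ge0. Qed.

(** With [a = c] the walk goes to a neighbour [b] and back, then around a triangle at [a]; the
    choice of [b] contributes the degree. *)
Lemma sum_walk5_degenerate :
  \sum_a \sum_b \sum_c \sum_d \sum_e (a == c)%:R * walk5 a b c d e =
  \sum_a dg a * closed3 a.
Proof.
apply: eq_bigr => a _; rewrite mulr_suml; apply: eq_bigr => b _.
transitivity (\sum_c (a == c)%:R * (\sum_d \sum_e walk5 a b c d e)).
  by apply: eq_bigr => c _; rewrite mulr_sumr; apply: eq_bigr => d _; rewrite mulr_sumr.
rewrite sum_eqb mulr_sumr; apply: eq_bigr => d _.
rewrite mulr_sumr; apply: eq_bigr => e _.
by rewrite /walk5 /tri (adjrC R b a) adjr_sq !mulrA.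
Qed.

Lemma sum5_rot (F : G -> G -> G -> G -> G -> R) :
  \sum_a \sum_b \sum_c \sum_d \sum_e F b c d e a =
  \sum_a \sum_b \sum_c \sum_d \sum_e F a b c d e.
Proof.
rewrite exchange_big; apply: eq_bigr => b _.
rewrite exchange_big; apply: eq_bigr => c _.
rewrite exchange_big; apply: eq_bigr => d _.
by rewrite exchange_big.
Qed.

(** Makes the five positions of a repetition at distance two contribute equally. *)
Lemma sum_walk5_rot (P : G -> G -> G -> G -> G -> R) :
  \sum_a \sum_b \sum_c \sum_d \sum_e P b c d e a * walk5 a b c d e =
  \sum_a \sum_b \sum_c \sum_d \sum_e P a b c d e * walk5 a b c d e.
Proof.
rewrite -[RHS]sum5_rot.
by do 5!(apply: eq_bigr => ? _); rewrite walk5_rot.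
Qed.

(** Closed 5-walks with distinct vertices are elements of [C5_homs], written as quintuples. *)
Lemma sum_walk5_uniq_le :
  \sum_a \sum_b \sum_c \sum_d \sum_e
     (uniq [:: a; b; c; d; e])%:R * walk5 a b c d e <= (10 * num_C5 G)%:R.
Proof.
pose Q := [set p : G * G * G * G * G | [&& uniq
  [:: p.1.1.1.1; p.1.1.1.2; p.1.1.2; p.1.2; p.2],
  adj p.1.1.1.1 p.1.1.1.2, adj p.1.1.1.2 p.1.1.2, adj p.1.1.2 p.1.2, adj p.1.2 p.2
  & adj p.2 p.1.1.1.1]]%SET.
have -> : \sum_a \sum_b \sum_c \sum_d \sum_e
     (uniq [:: a; b; c; d; e])%:R * walk5 a b c d e = #|Q|%:R.
  pose u (p : G * G * G * G * G) :=
    uniq [:: p.1.1.1.1; p.1.1.1.2; p.1.1.2; p.1.2; p.2].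
  transitivity (\sum_a \sum_b \sum_c \sum_d \sum_e
     (u (a, b, c, d, e))%:R * walk5 a b c d e); first by [].
  have -> : Q = [set p | [&& u p, adj p.1.1.1.1 p.1.1.1.2, adj p.1.1.1.2 p.1.1.2,
    adj p.1.1.2 p.1.2, adj p.1.2 p.2 & adj p.2 p.1.1.1.1]]%SET by [].
  do 4!rewrite pair_bigA /=.
  rewrite -sum1_card natr_sum [RHS]big_mkcond /=.
  apply: eq_bigr => -[[[[a b] c] d] e] _; rewrite inE /= /walk5 /adjr.
  case: (u _) => /=; last by rewrite mul0r.
  by rewrite mul1r -!natrM !mulnb -!andbA; case: [&& _, _, _, _ & _].
rewrite ler_nat; apply: leq_trans (card_C5_homs_le G).
pose f (p : G * G * G * G * G) := [ffun i : 'I_5 =>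
  nth p.2 [:: p.1.1.1.1; p.1.1.1.2; p.1.1.2; p.1.2; p.2] i].
rewrite -(@card_in_imset _ _ f Q).
  apply: subset_leq_card; apply/fintype.subsetP => _ /imsetP [p pQ ->].
  move: pQ; rewrite !inE -/(uniq [:: _; _; _; _; _]) => /andP[up pA]; apply/andP; split.
    apply/injectiveP => i j; rewrite !ffunE => /eqP; rewrite nth_uniq //.
    by move/eqP/val_inj.
  case/and5P: pA => h1 h2 h3 h4 h5.
  by apply/forallP => -[[|[|[|[|[|i]]]]] hi]; rewrite !ffunE.
move=> [[[[a b] c] d] e] [[[[a' b'] c'] d'] e'] _ _ /ffunP E.
have := E ord0; have := E (ordS ord0); have := E (ordS (ordS ord0)).
have := E (ordS (ordS (ordS ord0))); have := E (ordS (ordS (ordS (ordS ord0)))).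
by rewrite !ffunE /= => -> -> -> -> ->.
Qed.

(* Consecutive vertices of a closed 5-walk differ, so a repetition is at
   distance two, and the walk is a triangle with a pendant edge. *)
Lemma walks5_le :
  walks5 R G <= 10 * (num_C5 G)%:R + 5 * \sum_a dg a * closed3 a.
Proof.
pose r1 := fun a b c d e : G => (a == c)%:R : R.
have pt a b c d e : walk5 a b c d e <=
   (uniq [:: a; b; c; d; e])%:R * walk5 a b c d e +
   (r1 a b c d e * walk5 a b c d e + r1 b c d e a * walk5 a b c d e +
    r1 c d e a b * walk5 a b c d e + r1 d e a b c * walk5 a b c d e +
    r1 e a b c d * walk5 a b c d e).
  rewrite -!mulrDl; have [->|w0] := eqVneq (walk5 a b c d e) 0; first by rewrite mulr0.
  rewrite ler_peMl ?walk5_ge0 // /r1 -!natrD ler1n.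
  move: w0; rewrite /walk5 !mulf_eq0 !negb_or /adjr !pnatr_eq0 !eqb0 !negbK.
  case/andP=> /andP[/andP[/andP[ab bc] cd] de] ea.
  have ne (x y : G) : adj x y -> (x == y) = false.
    by move=> xy; apply: contraTF xy => /eqP ->; rewrite adj_irrefl.
  rewrite /= !inE !negb_or (ne _ _ ab) (ne _ _ bc) (ne _ _ cd) (ne _ _ de).
  rewrite (eq_sym a e) (ne _ _ ea) (eq_sym d a) (eq_sym e b) /=.
  by do 5!case: eqP => //= _.
apply: (@le_trans _ _ (\sum_a \sum_b \sum_c \sum_d \sum_e
   ((uniq [:: a; b; c; d; e])%:R * walk5 a b c d e +
   (r1 a b c d e * walk5 a b c d e + r1 b c d e a * walk5 a b c d e +
    r1 c d e a b * walk5 a b c d e + r1 d e a b c * walk5 a b c d e +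
    r1 e a b c d * walk5 a b c d e)))).
  by do 5!(apply: ler_sum => ? _); exact: pt.
rewrite -[10]/(10%:R) -natrM.
have sD (F F' : G -> G -> G -> G -> G -> R) :
   \sum_a \sum_b \sum_c \sum_d \sum_e (F a b c d e + F' a b c d e) =
   \sum_a \sum_b \sum_c \sum_d \sum_e F a b c d e +
   \sum_a \sum_b \sum_c \sum_d \sum_e F' a b c d e.
  rewrite -big_split; apply: eq_bigr => a _; rewrite -big_split; apply: eq_bigr => b _.
  rewrite -big_split; apply: eq_bigr => c _; rewrite -big_split; apply: eq_bigr => d _.
  by rewrite -big_split.
rewrite sD lerD ?sum_walk5_uniq_le // !sD.
have e1 := sum_walk5_rot r1.
have e2 := etrans (sum_walk5_rot (fun a b c d e => r1 b c d e a)) e1.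
have e3 := etrans (sum_walk5_rot (fun a b c d e => r1 c d e a b)) e2.
have e4 := etrans (sum_walk5_rot (fun a b c d e => r1 d e a b c)) e3.
rewrite e1 e2 e3 e4 /r1 sum_walk5_degenerate.
by rewrite le_eqVlt; apply/orP; left; apply/eqP; ring.
Qed.

End ClosedWalks.

(** * Pairs of edges spanning a 4-cycle *)

Section Quadruples.
Variables (R : realType) (G : sgraph).
Local Notation al := (@adjr R G).
Local Notation dg := (@degr R G).
Local Notation m := ((num_edges G)%:R : R).

(* Pairs of darts [(a, b)], [(c, d)] that do not span a 4-cycle. *)
Definition bad (a b c d : G) : R :=
  al a b * al c d * (1 - al b c * al d a) * (1 - al b d * al c a).

Definition bads : R := \sum_a \sum_b \sum_c \sum_d bad a b c d.

Definition codeg (a b : G) : R := \sum_c al b c * al c a.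

Lemma adjr_bool (a b : G) : al a b = 0 \/ al a b = 1.
Proof. by rewrite /adjr; case: adj; [right | left]. Qed.

Lemma bad_ge0 a b c d : 0 <= bad a b c d.
Proof.
have p01 (x y z t : G) : 0 <= 1 - al x y * al z t.
  by rewrite subr_ge0 -[leRHS]mulr1 ler_pM ?adjr_ge0 ?adjr_le1.
by rewrite /bad !mulr_ge0 ?adjr_ge0.
Qed.

Lemma walks3_codeg : walks3 R G = \sum_a \sum_b al a b * codeg a b.
Proof.
apply: eq_bigr => a _; apply: eq_bigr => b _; rewrite mulr_sumr.
by apply: eq_bigr => c _; rewrite /tri mulrA.
Qed.

Lemma degr_ge0 a : 0 <= dg a.
Proof. by apply: sumr_ge0 => b _; exact: adjr_ge0. Qed.

Lemma sum_degr : \sum_a dg a = 2 * m.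
Proof. exact: sum_adjr. Qed.

(** The darts inside a set of weight [|N|] number at most both [|N|^2] and [2 m]. The first bound
    serves for [|N| <= 2 s], the second for larger [|N|]. *)
Lemma sum_adjr_in_le (N : G -> R) (s : R) : 0 <= s -> m <= s ^+ 2 ->
  (forall c, 0 <= N c <= 1) ->
  \sum_c \sum_d al c d * (N c * N d) <= 2 * s * \sum_c N c.
Proof.
move=> s0 ms N01.
have N0 c : 0 <= N c by case/andP: (N01 c).
have N1 c : N c <= 1 by case/andP: (N01 c).
have S0 : 0 <= \sum_c N c by apply: sumr_ge0 => c _.
have [Ns|/ltW Ns] := leP (\sum_c N c) (2 * s).
  apply: (@le_trans _ _ ((\sum_c N c) * (\sum_d N d))); last exact: ler_wpM2r.
  rewrite mulr_suml; apply: ler_sum => c _; rewrite mulr_sumr; apply: ler_sum => d _.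
  by rewrite ler_piMl ?mulr_ge0 ?adjr_le1.
apply: (@le_trans _ _ (2 * m)).
  rewrite -sum_adjr; apply: ler_sum => c _; apply: ler_sum => d _.
  by rewrite ler_piMr ?adjr_ge0 // -[leRHS]mulr1 ler_pM.
have : 2 * s * (2 * s) <= 2 * s * \sum_c N c by rewrite ler_wpM2l ?mulr_ge0.
by move: ms (sqr_ge0 s); clear; lra.
Qed.

(** Expanding the product gives all pairs of darts, minus two counts of closed 4-walks, plus the
    pairs inducing a complete graph on four vertices. The latter are darts inside the common
    neighbourhood of an adjacent pair. *)
Lemma bads_le (s : R) : 0 <= s -> m <= s ^+ 2 ->
  bads <= 4 * m ^+ 2 - 2 * walks4 R G + 2 * s * walks3 R G.
Proof.
move=> s0 ms.
have e a b c d : bad a b c d = al a b * al c d -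
   (al a b * al b c * al c d * al d a + al a b * al b d * al d c * al c a) +
   al a b * (al c d * ((al b c * al c a) * (al b d * al d a))).
  by rewrite /bad (adjrC R d c); ring.
have sD (F F' : G -> G -> G -> G -> R) :
   \sum_a \sum_b \sum_c \sum_d (F a b c d + F' a b c d) =
   \sum_a \sum_b \sum_c \sum_d F a b c d + \sum_a \sum_b \sum_c \sum_d F' a b c d.
  rewrite -big_split; apply: eq_bigr => a _; rewrite -big_split; apply: eq_bigr => b _.
  by rewrite -big_split; apply: eq_bigr => c _; rewrite -big_split.
have sN (F : G -> G -> G -> G -> R) :
   \sum_a \sum_b \sum_c \sum_d - F a b c d = - \sum_a \sum_b \sum_c \sum_d F a b c d.
  rewrite -sumrN; apply: eq_bigr => a _; rewrite -sumrN; apply: eq_bigr => b _.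
  by rewrite -sumrN; apply: eq_bigr => c _; rewrite -sumrN.
have e1 : \sum_a \sum_b \sum_c \sum_d al a b * al c d = 4 * m ^+ 2.
  transitivity ((\sum_a \sum_b al a b) * (\sum_c \sum_d al c d)).
    rewrite mulr_suml; apply: eq_bigr => a _; rewrite mulr_suml.
    apply: eq_bigr => b _; rewrite mulr_sumr; apply: eq_bigr => c _.
    by rewrite mulr_sumr.
  by rewrite sum_adjr; ring.
have e2 : \sum_a \sum_b \sum_c \sum_d al a b * al b d * al d c * al c a = walks4 R G.
  by apply: eq_bigr => a _; apply: eq_bigr => b _; rewrite exchange_big.
have e3 : \sum_a \sum_b \sum_c \sum_d
    al a b * (al c d * ((al b c * al c a) * (al b d * al d a))) <= 2 * s * walks3 R G.
  rewrite walks3_codeg mulr_sumr; apply: ler_sum => a _.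
  rewrite mulr_sumr; apply: ler_sum => b _; rewrite mulrCA.
  apply: (@le_trans _ _ (al a b *
    \sum_c \sum_d al c d * ((al b c * al c a) * (al b d * al d a)))).
    by rewrite mulr_sumr; apply: ler_sum => c _; rewrite mulr_sumr.
  rewrite ler_wpM2l ?adjr_ge0 //.
  apply: (sum_adjr_in_le (N := fun c => al b c * al c a)) => // c.
  by rewrite mulr_ge0 ?adjr_ge0 //= -[leRHS]mulr1 ler_pM ?adjr_ge0 ?adjr_le1.
rewrite /bads.
under eq_bigr => a _ do under eq_bigr => b _ do under eq_bigr => c _ do
  under eq_bigr => d _ do rewrite e.
rewrite sD sD sN sD e1 e2 -/(walks4 R G); move: e3; clear.
by set X := \sum_a _; set W := walks3 _ _; lra.
Qed.

Lemma ler_sum1 (I : finType) (F : I -> R) i : (forall j, 0 <= F j) -> F i <= \sum_j F j.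
Proof. by move=> F0; rewrite (bigD1 i) //= lerDl sumr_ge0. Qed.

(** A neighbour [w] of [u] and a neighbour [z] of [v] not adjacent to [u] give a bad pair of darts
    unless [w] and [z] are adjacent; the exceptions number at most [2 m]. *)
Lemma twins (u v : G) : dg u * \sum_z al v z * (1 - al u z) <= bads + 2 * m.
Proof.
have badS : \sum_w \sum_z bad u w v z <= bads.
  apply: (@le_trans _ _ (\sum_b \sum_c \sum_d bad u b c d)); last first.
    by apply: (ler_sum1 (F := fun a => \sum_b \sum_c \sum_d bad a b c d)) => a;
      do 3!apply: sumr_ge0 => ? _; exact: bad_ge0.
  apply: ler_sum => b _; apply: (ler_sum1 (F := fun c => \sum_d bad u b c d)) => c.
  by apply: sumr_ge0 => d _; exact: bad_ge0.
have : \sum_w \sum_z (al u w * (al v z * (1 - al u z)) - al w z) <= bads.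
  apply: le_trans badS; apply: ler_sum => w _; apply: ler_sum => z _.
  rewrite /bad (adjrC R z u) (adjrC R v u).
  by have [-> | ->] := adjr_bool u w; have [-> | ->] := adjr_bool v z;
    have [-> | ->] := adjr_bool u z; have [-> | ->] := adjr_bool w z;
    have [-> | ->] := adjr_bool w v; have [-> | ->] := adjr_bool u v; lra.
rewrite -lerBlDr; apply: le_trans.
rewrite -sum_adjr mulr_suml -sumrB; apply: ler_sum => w _.
by rewrite mulr_sumr -sumrB.
Qed.

(** Counts darts, so each edge avoiding [L] contributes 2. *)
Definition outside (L : {set G}) : R :=
  \sum_(c | c \notin L) \sum_(d | d \notin L) al c d.

Lemma outside_ge0 L : 0 <= outside L.
Proof. by do 2!apply: sumr_ge0 => ? _; exact: adjr_ge0. Qed.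

(** For a dart [(c, d)] avoiding [L], at least [x] neighbours [w] of [u] are adjacent to neither [c]
    nor [d], and each makes [(u, w)], [(c, d)] a bad pair. *)
Lemma outside_le (L : {set G}) (u : G) (x : R) :
  (forall c, c \notin L -> 2 * dg c + x <= dg u) -> outside L * x <= bads.
Proof.
move=> hx.
apply: (@le_trans _ _ (\sum_b \sum_c \sum_d bad u b c d)); last first.
  by apply: (ler_sum1 (F := fun a => \sum_b \sum_c \sum_d bad a b c d)) => a;
    do 3!apply: sumr_ge0 => ? _; exact: bad_ge0.
rewrite exchange_big mulr_suml [leRHS](bigID (mem L)) /= addrC -[leLHS]addr0 lerD //;
  last by do 3!apply: sumr_ge0 => ? _; exact: bad_ge0.
apply: ler_sum => c cL; rewrite exchange_big mulr_suml [leRHS](bigID (mem L)) /=.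
rewrite addrC -[leLHS]addr0 lerD //; last by do 2!apply: sumr_ge0 => ? _; exact: bad_ge0.
apply: ler_sum => d dL.
apply: (@le_trans _ _ (al c d * (dg u - dg c - dg d))).
  rewrite ler_wpM2l ?adjr_ge0 //; have := hx c cL; have := hx d dL; lra.
rewrite /degr -!sumrB mulr_sumr; apply: ler_sum => w _.
rewrite /bad (adjrC R d u) (adjrC R c u) (adjrC R w c) (adjrC R w d).
by have [-> | ->] := adjr_bool u w; have [-> | ->] := adjr_bool c d;
  have [-> | ->] := adjr_bool c w; have [-> | ->] := adjr_bool d w;
  have [-> | ->] := adjr_bool u d; have [-> | ->] := adjr_bool u c; lra.
Qed.

End Quadruples.

(** * Triangles and vertices of large degree *)

(** [e] is the number of edges inside [L]. Its integrality lets the case of three large vertices be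
    split into [e <= 1] and [e >= 2]. *)
Lemma sum_adjr_in_even (R : realType) (G : sgraph) (L : {set G}) :
  exists e : nat, \sum_(a in L) \sum_(b in L) adjr R a b = 2 * e%:R.
Proof.
pose r a b := [&& a \in L, b \in L & adj a b].
have rs : symmetric r by move=> a b; rewrite /r adj_sym andbCA.
have ri : irreflexive r by move=> a; rewrite /r adj_irrefl !andbF.
exists (num_edges (SGraph rs ri)); rewrite -sum_adjr /= [LHS]big_mkcond.
apply: eq_bigr => a _; case: ifP => aL; last first.
  by rewrite big1 // => b _; rewrite /adjr /= /r aL.
rewrite big_mkcond; apply: eq_bigr => b _; rewrite /adjr /= /r aL /=.
by case: (b \in L).
Qed.

Section LargeVertices.
Variables (R : realType) (G : sgraph).
Local Notation al := (@adjr R G).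
Local Notation dg := (@degr R G).
Local Notation m := ((num_edges G)%:R : R).
Local Notation W := (walks3 R G).

(* Summed over unordered triangles [T] this is [6 * \sum_T (m - d(T))]. *)
Definition excess : R := \sum_a \sum_b \sum_c tri R a b c * (m - dg a - dg b - dg c).

Lemma tri_ge0 (a b c : G) : 0 <= tri R a b c.
Proof. by rewrite !mulr_ge0 ?adjr_ge0. Qed.

Lemma tri_rot (a b c : G) : tri R a b c = tri R b c a.
Proof. by rewrite /tri; ring. Qed.

Lemma walks3_ge0 : 0 <= W.
Proof. by do 3!apply: sumr_ge0 => ? _; exact: tri_ge0. Qed.

Lemma sum3_rot (F : G -> G -> G -> R) :
  \sum_a \sum_b \sum_c F b c a = \sum_a \sum_b \sum_c F a b c.
Proof. by rewrite exchange_big; apply: eq_bigr => b _; rewrite exchange_big. Qed.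

Lemma sum3_tri_rot (P : G -> G -> G -> R) :
  \sum_a \sum_b \sum_c tri R a b c * P b c a = \sum_a \sum_b \sum_c tri R a b c * P a b c.
Proof.
rewrite -[RHS]sum3_rot.
by do 3!apply: eq_bigr => ? _; rewrite tri_rot.
Qed.

Lemma sum3D (F F' : G -> G -> G -> R) :
  \sum_a \sum_b \sum_c (F a b c + F' a b c) =
  \sum_a \sum_b \sum_c F a b c + \sum_a \sum_b \sum_c F' a b c.
Proof.
rewrite -big_split; apply: eq_bigr => a _; rewrite -big_split.
by apply: eq_bigr => b _; rewrite -big_split.
Qed.

Lemma sum3Z (x : R) (F : G -> G -> G -> R) :
  \sum_a \sum_b \sum_c x * F a b c = x * \sum_a \sum_b \sum_c F a b c.
Proof.
rewrite mulr_sumr; apply: eq_bigr => a _; rewrite mulr_sumr.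
by apply: eq_bigr => b _; rewrite mulr_sumr.
Qed.

Lemma ler_sum3 (F F' : G -> G -> G -> R) : (forall a b c, F a b c <= F' a b c) ->
  \sum_a \sum_b \sum_c F a b c <= \sum_a \sum_b \sum_c F' a b c.
Proof. by move=> h; do 3!apply: ler_sum => ? _; exact: h. Qed.

(** Up to the factor 5/3, the right-hand side is the spectral lower bound for [walks5] minus the
    bound for degenerate walks in [walks5_le]. *)
Lemma excessE : excess = m * W - 3 * \sum_a dg a * closed3 R a.
Proof.
have S1 : \sum_a \sum_b \sum_c tri R a b c * dg a = \sum_a dg a * closed3 R a.
  apply: eq_bigr => a _; rewrite mulr_sumr; apply: eq_bigr => b _.
  by rewrite mulr_sumr; apply: eq_bigr => c _; rewrite mulrC.
have S2 := sum3_tri_rot (fun a b c => dg a).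
have S3 := etrans (sum3_tri_rot (fun a b c => dg b)) S2.
transitivity (\sum_a \sum_b \sum_c (m * tri R a b c + -1 * (tri R a b c * dg a) +
   -1 * (tri R a b c * dg b) + -1 * (tri R a b c * dg c))).
  by do 3!apply: eq_bigr => ? _; ring.
by rewrite !sum3D !sum3Z S3 S2 S1 -/W; ring.
Qed.

Lemma excess_small_degrees : (forall v, dg v <= m / 6) -> m / 2 * W <= excess.
Proof.
move=> h; rewrite -sum3Z; apply: ler_sum3 => a b c.
by rewrite mulrC ler_wpM2l ?tri_ge0 //; have := h a; have := h b; have := h c; lra.
Qed.

Section Split.
Variables (L : {set G}).
Let chi (a : G) : R := (a \in L)%:R.
(** By rotation, [3 * tri1] sums over closed 3-walks the number of their vertices in [L], and
    [3 * tri2] the number of their pairs of vertices in [L]. *)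
Definition tri1 : R := \sum_a \sum_b \sum_c tri R a b c * chi a.
Definition tri2 : R := \sum_a \sum_b \sum_c tri R a b c * (chi a * chi b).
Definition tri3 : R := \sum_a \sum_b \sum_c tri R a b c * (chi a * chi b * chi c).

Lemma chi_bool a : chi a = 0 \/ chi a = 1.
Proof. by rewrite /chi; case: (_ \in _); [right|left]. Qed.

Lemma excess_ge (D t : R) : 0 <= D -> (forall v, dg v <= chi v * D + t) ->
  (m - 3 * t) * W - 3 * D * tri1 <= excess.
Proof.
move=> D0 hD.
have S2 := sum3_tri_rot (fun a b c => chi a).
have S3 := etrans (sum3_tri_rot (fun a b c => chi b)) S2.
have -> : (m - 3 * t) * W - 3 * D * tri1 = \sum_a \sum_b \sum_c
   ((m - 3 * t) * tri R a b c + - D * (tri R a b c * chi a) +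
   - D * (tri R a b c * chi b) + - D * (tri R a b c * chi c)).
  by rewrite !sum3D !sum3Z S3 S2 -/tri1 -/W; ring.
apply: ler_sum3 => a b c.
have := ler_wpM2l (tri_ge0 a b c) (hD a).
have := ler_wpM2l (tri_ge0 a b c) (hD b).
by have := ler_wpM2l (tri_ge0 a b c) (hD c); lra.
Qed.

(** A triangle has at most two vertices in [L], or all three. *)
Lemma tri1_le_tri3 : 3 * tri1 <= 2 * W + tri3.
Proof.
have S2 := sum3_tri_rot (fun a b c => chi a).
have S3 := etrans (sum3_tri_rot (fun a b c => chi b)) S2.
have -> : 3 * tri1 = \sum_a \sum_b \sum_c
   (tri R a b c * chi a + tri R a b c * chi b + tri R a b c * chi c).
  by rewrite !sum3D S3 S2 -/tri1; ring.
rewrite -sum3Z -sum3D; apply: ler_sum3 => a b c; have := tri_ge0 a b c.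
by have [-> | ->] := chi_bool a; have [-> | ->] := chi_bool b;
  have [-> | ->] := chi_bool c; lra.
Qed.

(** A triangle with [j] vertices in [L] satisfies [j <= 1 + j (j - 1) / 2]. *)
Lemma tri1_le_tri2 : 3 * tri1 <= W + 3 * tri2.
Proof.
have S2 := sum3_tri_rot (fun a b c => chi a).
have S3 := etrans (sum3_tri_rot (fun a b c => chi b)) S2.
have U2 := sum3_tri_rot (fun a b c => chi a * chi b).
have U3 := etrans (sum3_tri_rot (fun a b c => chi b * chi c)) U2.
have -> : 3 * tri1 = \sum_a \sum_b \sum_c
   (tri R a b c * chi a + tri R a b c * chi b + tri R a b c * chi c).
  by rewrite !sum3D S3 S2 -/tri1; ring.
have -> : W + 3 * tri2 = \sum_a \sum_b \sum_c
   (tri R a b c + tri R a b c * (chi a * chi b) + tri R a b c * (chi b * chi c) +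
    tri R a b c * (chi c * chi a)).
  by rewrite !sum3D U3 U2 -/tri2 -/W; ring.
apply: ler_sum3 => a b c; have := tri_ge0 a b c.
by have [-> | ->] := chi_bool a; have [-> | ->] := chi_bool b;
  have [-> | ->] := chi_bool c; lra.
Qed.

(** Triangles with exactly two vertices in [L] contribute at least [x] each, those with fewer
    contribute nonnegatively and are dropped, and those inside [L] are charged as an error. *)
Lemma excess_ge_tri2 (D t x : R) : 0 <= x -> 0 <= t ->
  (forall v, dg v <= chi v * D + t) -> 0 <= D -> x + 2 * D + 3 * t <= m ->
  x * (3 * (tri2 - tri3)) - (x + 3 * D + 3 * t) * tri3 <= excess.
Proof.
move=> x0 t0 hD D0 hx.
have U2 := sum3_tri_rot (fun a b c => chi a * chi b * (1 - chi c)).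
have U3 := etrans (sum3_tri_rot (fun a b c => chi b * chi c * (1 - chi a))) U2.
have E : \sum_a \sum_b \sum_c tri R a b c * (chi a * chi b * (1 - chi c)) =
   tri2 - tri3.
  transitivity (\sum_a \sum_b \sum_c (tri R a b c * (chi a * chi b) +
     -1 * (tri R a b c * (chi a * chi b * chi c)))).
    by do 3!apply: eq_bigr => ? _; ring.
  by rewrite !sum3D sum3Z mulN1r.
have -> : x * (3 * (tri2 - tri3)) - (x + 3 * D + 3 * t) * tri3 = \sum_a \sum_b \sum_c
   (x * (tri R a b c * (chi a * chi b * (1 - chi c))) +
    x * (tri R a b c * (chi b * chi c * (1 - chi a))) +
    x * (tri R a b c * (chi c * chi a * (1 - chi b))) +
    - (x + 3 * D + 3 * t) * (tri R a b c * (chi a * chi b * chi c))).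
  by rewrite !sum3D !sum3Z U3 U2 E -/tri3; ring.
apply: ler_sum3 => a b c; have T0 := tri_ge0 a b c.
have := ler_wpM2l T0 (hD a); have := ler_wpM2l T0 (hD b); have := ler_wpM2l T0 (hD c).
have := ler_wpM2l T0 hx; have := mulr_ge0 T0 x0; have := mulr_ge0 T0 t0; have := mulr_ge0 T0 D0.
have [-> | ->] := chi_bool a; have [-> | ->] := chi_bool b;
  have [-> | ->] := chi_bool c; rewrite ?mulrDr; lra.
Qed.

Lemma tri3_le : tri3 <= #|L|%:R ^+ 3.
Proof.
have chiS : \sum_a chi a = #|L|%:R.
  by rewrite -sum1_card natr_sum [RHS]big_mkcond; apply: eq_bigr => a _; rewrite /chi; case: (_ \in _).
have -> : #|L|%:R ^+ 3 = \sum_a \sum_b \sum_c chi a * chi b * chi c.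
  rewrite -chiS !exprS expr0 mulr1 mulr_suml; apply: eq_bigr => a _.
  rewrite mulr_suml mulr_sumr; apply: eq_bigr => b _.
  by rewrite !mulr_sumr; apply: eq_bigr => c _; rewrite mulrA.
apply: ler_sum3 => a b c; rewrite ler_piMl ?mulr_ge0 ?ler0n // /tri.
by rewrite -[leRHS]mulr1 ler_pM ?mulr_ge0 ?adjr_ge0 ?adjr_le1 // -[leRHS]mulr1
  ler_pM ?adjr_ge0 ?adjr_le1.
Qed.

Lemma tri3_ge0 : 0 <= tri3.
Proof.
by do 3!apply: sumr_ge0 => ? _; rewrite !mulr_ge0 ?tri_ge0 ?ler0n ?adjr_ge0.
Qed.

Lemma tri2E : tri2 = \sum_(a in L) \sum_(b in L) al a b * codeg R a b.
Proof.
rewrite [RHS]big_mkcond; apply: eq_bigr => a _; rewrite /chi; case: ifP => aL; last first.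
  by rewrite big1 // => b _; rewrite big1 // => c _; rewrite mul0r mulr0.
rewrite [RHS]big_mkcond; apply: eq_bigr => b _; case: ifP => bL; last first.
  by rewrite big1 // => c _; rewrite mulr0 mulr0.
by rewrite mulr_sumr; apply: eq_bigr => c _; rewrite mulr1 mulr1 /tri mulrA.
Qed.

Lemma tri2_le (D : R) : (forall v, v \in L -> dg v <= D) ->
  tri2 <= (\sum_(a in L) \sum_(b in L) al a b) * D.
Proof.
move=> hD; rewrite tri2E mulr_suml; apply: ler_sum => a aL.
rewrite mulr_suml; apply: ler_sum => b bL; rewrite ler_wpM2l ?adjr_ge0 //.
apply: le_trans (hD b bL); apply: ler_sum => c _.
by rewrite ler_piMr ?adjr_ge0 ?adjr_le1.
Qed.

Lemma tri2_ge (D : R) : (forall u v, u \in L -> v \in L -> D <= codeg R u v) ->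
  (\sum_(a in L) \sum_(b in L) al a b) * D <= tri2.
Proof.
move=> hD; rewrite tri2E mulr_suml; apply: ler_sum => a aL.
by rewrite mulr_suml; apply: ler_sum => b bL; rewrite ler_wpM2l ?adjr_ge0 ?hD.
Qed.

(** A triangle through [p] is determined by the opposite dart, which avoids [p]. *)
Lemma tri1_singleton (p : G) : L = [set p]%SET -> tri1 <= outside R L.
Proof.
move=> Lp; have e : tri1 = \sum_b \sum_c tri R p b c.
  rewrite /tri1 (bigD1 p) //= [X in _ + X]big1 => [|a ap].
    rewrite addr0; apply: eq_bigr => b _; apply: eq_bigr => c _.
    by rewrite /chi Lp inE eqxx mulr1.
  by do 2!(rewrite big1 // => ? _); rewrite /chi Lp inE (negPf ap) mulr0.
rewrite e /outside Lp.
rewrite (bigD1 p) //= [X in X + _]big1 ?add0r => [|c _]; last first.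
  by rewrite /tri adjrr !mul0r.
rewrite [leRHS](eq_bigl (fun b => b != p)); last by move=> b; rewrite inE.
apply: ler_sum => b bp.
rewrite (bigD1 p) //= {1}/tri adjrr mulr0 add0r.
rewrite [leRHS](eq_bigl (fun b => b != p)); last by move=> c; rewrite inE.
apply: ler_sum => c cp; rewrite /tri mulrAC ler_piMl ?adjr_ge0 //.
by rewrite -[leRHS]mulr1 ler_pM ?adjr_ge0 ?adjr_le1.
Qed.

(** The degree sum over [L] counts edges inside [L] twice, edges leaving [L] once and edges avoiding
    [L] never. *)
Lemma sum_degr_in : \sum_(a in L) dg a =
  m + (\sum_(a in L) \sum_(b in L) al a b - outside R L) / 2.
Proof.
have s1 : \sum_(a in L) dg a = \sum_(a in L) \sum_(b in L) al a b +
    \sum_(a in L) \sum_(b | b \notin L) al a b.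
  by rewrite -big_split; apply: eq_bigr => a _; rewrite /degr (bigID (mem L)).
have s2 : \sum_(a | a \notin L) dg a =
    \sum_(a in L) \sum_(b | b \notin L) al a b + outside R L.
  rewrite [X in _ = X + _]exchange_big -big_split; apply: eq_bigr => a _.
  rewrite /degr [LHS](bigID (mem L)) /=; congr (_ + _).
  by apply: eq_bigr => b _; rewrite adjrC.
have := sum_degr R G; rewrite (bigID (mem L)) /= s2 s1; clear; lra.
Qed.

End Split.
End LargeVertices.

(** * Case analysis on the number of large vertices *)

Section Dichotomy.
Variables (R : realType) (G : sgraph).
Local Notation al := (@adjr R G).
Local Notation dg := (@degr R G).
Local Notation m := ((num_edges G)%:R : R).
Local Notation W := (walks3 R G).

Lemma codeg_twins (u v : G) : codeg R u v = dg v - \sum_z al v z * (1 - al u z).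
Proof.
rewrite /degr -sumrB; apply: eq_bigr => z _.
by rewrite (adjrC R z u); ring.
Qed.

Lemma codeg_le (u v : G) : codeg R u v <= dg u.
Proof.
apply: ler_sum => z _; rewrite (adjrC R z u) ler_piMl ?adjr_ge0 ?adjr_le1 //.
Qed.

Lemma sum_adjr_in_le_card (L : {set G}) :
  \sum_(a in L) \sum_(b in L) al a b <= #|L|%:R ^+ 2.
Proof.
have cardE (F : G -> R) : (forall a, F a <= #|L|%:R) -> \sum_(a in L) F a <= #|L|%:R ^+ 2.
  move=> hF; apply: le_trans (ler_sum _ (fun a _ => hF a)) _.
  by rewrite sumr_const expr2 mulr_natr.
apply: cardE => a; rewrite -sum1_card natr_sum; apply: ler_sum => b _.
exact: adjr_le1.
Qed.

(** The spine is [pq], and at most [m / 16] edges avoid it. The common neighbour keeps the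
    coefficient [cod - 1] nonnegative in the eigenvector comparison. *)
Definition near_book : Prop := exists p q : G,
  [/\ adj p q, outside R [set p; q]%SET <= m / 8 & 1 <= codeg R p q].

(** Common hypotheses of the cases below: [L] is the set of large vertices and [t] absorbs all error
    terms. *)
Record large_split (L : {set G}) (t : R) : Prop := LargeSplit {
  large_m : 0 < m;
  large_t : 0 <= t;
  large_tm : t <= m / 20;
  large_walks3 : 3 * m - t <= W;
  large_card : 6 * #|L|%:R ^+ 3 <= t;
  large_small : forall v, v \notin L -> dg v <= t;
  large_ub : forall v, v \in L -> #|L|%:R * dg v <= m + t;
  large_lb : forall v, v \in L -> m - t <= #|L|%:R * dg v;
  large_twin : forall u v, u \in L -> v \in L -> dg v - t <= codeg R u v;
  large_out : outside R L <= t }.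

(** Allowing any [k] up to the size of [L] treats all sizes from 4 on with [k = 4]. *)
Lemma large_degree_bound L t (k : nat) : large_split L t -> (0 < k <= #|L|)%N ->
  forall v, dg v <= (v \in L)%:R * ((m + t) / k%:R) + t.
Proof.
move=> [m0 t0 tm W3 L3 small largeU largeL twin outL] /andP[k0 kL] v; case: (boolP (v \in L)) => vL.
  have kR : 0 < k%:R :> R by rewrite ltr0n.
  have : k%:R * dg v <= m + t.
    by apply: le_trans (largeU v vL); rewrite ler_wpM2r ?degr_ge0 // ler_nat.
  by rewrite mul1r mulrC -ler_pdivlMr //; move: t0; lra.
by rewrite mul0r add0r small.
Qed.

(** Up to errors, large degrees are at most [m / 4] and [3 * tri1 <= 2 W], so the excess is at least
    [m W / 2 >= (3/2) m^2]. *)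
Lemma excess_four L t : large_split L t -> (4 <= #|L|)%N -> (4 / 3 * m - 30 * t) * m <= excess R G.
Proof.
move=> LS k4; have hD := @large_degree_bound L t 4 LS k4.
case: LS => m0 t0 tm W3 L3 small largeU largeL twin outL.
have D0 : 0 <= (m + t) / 4 by move: t0 m0; clear; lra.
have := excess_ge D0 hD; have := tri1_le_tri3 R L; have := tri3_le R L.
have := walks3_ge0 R G.
move: m0 t0 tm W3 L3; clear; set x := tri1 R L; set y := tri3 R L; set w := W.
set k := #|L|%:R ^+ 3; move=> m0 t0 tm W3 L3 w0 yk xw E.
have e1 : (m + t) / 4 * (3 * x) <= (m + t) / 4 * (2 * w + t).
  by apply: ler_wpM2l; lra.
have e2 : (m / 2 - 7 / 2 * t) * (3 * m - t) <= (m / 2 - 7 / 2 * t) * w.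
  by apply: ler_wpM2l; lra.
have e3 : t * t <= t * (m / 20) by rewrite ler_wpM2l.
have e4 : 0 <= m * t by rewrite mulr_ge0 // ltW.
by have := sqr_ge0 m; have := sqr_ge0 t; lra.
Qed.

(** Large degrees are about [m / 3]. With at most one edge inside [L], [tri2] is at most about
    [2 m / 3] and the excess at least about [(2/3) m W - (2/3) m^2 >= (4/3) m^2]. With two or more,
    [tri2] is at least about [4 m / 3] and each triangle on such an edge leaves about [m / 3], again
    giving [(4/3) m^2]. *)
Lemma excess_three L t : large_split L t -> #|L| = 3%N -> (4 / 3 * m - 30 * t) * m <= excess R G.
Proof.
move=> LS k3; have hk : (0 < 3 <= #|L|)%N by rewrite k3.
case: (LS) => m0 t0 tm W3 L3 small largeU largeL twin outL.
have hD := large_degree_bound LS hk.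
have D0 : 0 <= (m + t) / 3 by move: t0 m0; clear; lra.
have [e eE] := sum_adjr_in_even R L.
have [e1|e2] := leqP e 1.
  have hU v : v \in L -> dg v <= (m + t) / 3.
    by move=> /largeU; rewrite k3; clear; lra.
  have := tri2_le hU; rewrite eE => T2.
  have {}T2 : tri2 R L <= 2 * ((m + t) / 3).
    apply: le_trans T2 _; rewrite ler_wpM2r // -natrM -[leRHS]/(2%:R) ler_nat.
    by rewrite -[leqRHS]muln1 leq_mul2l.
  have := excess_ge D0 hD; have := tri1_le_tri2 R L; have := walks3_ge0 R G.
  move: m0 t0 tm W3 T2 D0; clear; set x := tri1 R L; set y := tri2 R L; set w := W.
  move=> m0 t0 tm W3 T2 D0 w0 xw E.
  have f1 : (m + t) / 3 * (3 * x) <= (m + t) / 3 * (w + 3 * (2 * ((m + t) / 3))).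
    by apply: ler_wpM2l; lra.
  have f2 : (2 / 3 * m - 10 / 3 * t) * (3 * m - t) <= (2 / 3 * m - 10 / 3 * t) * w.
    by apply: ler_wpM2l; lra.
  have f3 : t * t <= t * (m / 20) by rewrite ler_wpM2l.
  have f4 : 0 <= m * t by rewrite mulr_ge0 // ltW.
  by have := sqr_ge0 t; lra.
have hC u v : u \in L -> v \in L -> (m - 4 * t) / 3 <= codeg R u v.
  by move=> uL vL; apply: le_trans (twin u v uL vL); have := largeL v vL; rewrite k3; clear; lra.
have := tri2_ge hC; rewrite eE => T2.
have {}T2 : 4 * ((m - 4 * t) / 3) <= tri2 R L.
  apply: le_trans T2; rewrite ler_wpM2r //; first by move: m0 tm; clear; lra.
  rewrite -natrM -[leLHS]/(4%:R) ler_nat; move: e2; clear; lia.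
have x0 : 0 <= (m - 12 * t) / 3 by move: tm; clear -m0; lra.
have := @excess_ge_tri2 R G L _ t _ x0 t0 hD D0.
have := tri3_le R L; have := tri3_ge0 R L.
move: m0 t0 tm W3 T2 D0 L3 x0; clear; set y := tri2 R L; set z := tri3 R L.
move=> m0 t0 tm W3 T2 D0 L3 x0 z0 zL E.
have {}E := E _; have := E ltac:(lra) => {}E.
have f1 : (m - 12 * t) / 3 * (3 * (4 * ((m - 4 * t) / 3))) <= (m - 12 * t) / 3 * (3 * y).
  by apply: ler_wpM2l; lra.
have zt : 6 * z <= t by lra.
have f2 : m * (6 * z) <= m * t by rewrite ler_wpM2l // ltW.
have f3 : t * (6 * z) <= t * t by rewrite ler_wpM2l.
have f4 : t * t <= t * (m / 20) by rewrite ler_wpM2l.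
have f5 : 0 <= m * t by rewrite mulr_ge0 // ltW.
have f6 : 0 <= m * z by rewrite mulr_ge0 // ltW.
have f7 : 0 <= t * z by rewrite mulr_ge0.
by have := sqr_ge0 t; lra.
Qed.

(** If the two large vertices are not adjacent, then [tri2 = 0], so [3 * tri1 <= W], and degrees
    about [m / 2] leave an excess of about [m W / 2]. *)
Lemma excess_two L t : large_split L t -> #|L| = 2%N ->
  (4 / 3 * m - 30 * t) * m <= excess R G \/ near_book.
Proof.
move=> LS k2; have hk : (0 < 2 <= #|L|)%N by rewrite k2.
case: (LS) => m0 t0 tm W3 L3 small largeU largeL twin outL.
have /eqP/cards2P [p [q [pq Lpq]]] := k2.
have [apq|napq] := boolP (adj p q).
  right; exists p, q; split => //.
    by rewrite -Lpq; apply: le_trans outL _; move: tm m0; clear; lra.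
  have pL : p \in L by rewrite Lpq !inE eqxx.
  have qL : q \in L by rewrite Lpq !inE eqxx orbT.
  have : 0 < codeg R p q.
    apply: lt_le_trans (twin p q pL qL); have := largeL q qL; rewrite k2.
    by move: tm m0; clear; lra.
  (* The codegree is a natural number, so positive means at least 1. *)
  have -> : codeg R p q = (\sum_c (adj q c && adj c p : nat))%:R.
    by rewrite natr_sum; apply: eq_bigr => c _; rewrite -mulnb natrM.
  by rewrite ltr0n ler1n.
left; have hD := large_degree_bound LS hk.
have D0 : 0 <= (m + t) / 2 by move: t0 m0; clear; lra.
have hz u v : u \in L -> v \in L -> al u v = 0.
  rewrite Lpq !inE => /orP[/eqP->|/eqP->] /orP[/eqP->|/eqP->]; rewrite ?adjrr //.
    by rewrite /adjr (negPf napq).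
  by rewrite /adjr adj_sym (negPf napq).
have T2 : tri2 R L = 0.
  by rewrite tri2E big1 // => u uL; rewrite big1 // => v vL; rewrite hz // mul0r.
have := excess_ge D0 hD; have := tri1_le_tri2 R L; have := walks3_ge0 R G; rewrite T2.
move: m0 t0 tm W3 D0; clear; set x := tri1 R L; set w := W.
move=> m0 t0 tm W3 D0 w0 xw E.
have f1 : (m + t) / 2 * (3 * x) <= (m + t) / 2 * w by apply: ler_wpM2l; lra.
have f2 : (1 / 2 * m - 7 / 2 * t) * (3 * m - t) <= (1 / 2 * m - 7 / 2 * t) * w.
  by apply: ler_wpM2l; lra.
have f3 : t * t <= t * (m / 20) by rewrite ler_wpM2l.
have f4 : 0 <= m * t by rewrite mulr_ge0 // ltW.
by have := sqr_ge0 m; have := sqr_ge0 t; lra.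
Qed.

(** Almost no triangle meets the single large vertex, so the excess is about [m W]. *)
Lemma excess_one L t : large_split L t -> #|L| = 1%N -> (4 / 3 * m - 30 * t) * m <= excess R G.
Proof.
move=> LS k1; have hk : (0 < 1 <= #|L|)%N by rewrite k1.
case: (LS) => m0 t0 tm W3 L3 small largeU largeL twin outL.
have /eqP/cards1P [p Lp] := k1.
have hD := large_degree_bound LS hk.
have D0 : 0 <= (m + t) / 1 by move: t0 m0; clear; lra.
have T1 : tri1 R L <= t by apply: le_trans outL; exact: tri1_singleton Lp.
have := excess_ge D0 hD; have := walks3_ge0 R G.
move: m0 t0 tm W3 D0 T1; clear; set x := tri1 R L; set w := W.
move=> m0 t0 tm W3 D0 T1 w0 E.
have f1 : (m + t) / 1 * (3 * x) <= (m + t) / 1 * (3 * t) by apply: ler_wpM2l; lra.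
have f2 : (m - 3 * t) * (3 * m - t) <= (m - 3 * t) * w.
  by apply: ler_wpM2l; lra.
have f3 : t * t <= t * (m / 20) by rewrite ler_wpM2l.
have f4 : 0 <= m * t by rewrite mulr_ge0 // ltW.
by have := sqr_ge0 m; have := sqr_ge0 t; lra.
Qed.

(* [t = 2100 h m] absorbs all errors: there are at most 36 vertices of degree at
   least [m / 18], and the neighbourhoods of two of them differ by at most
   [55 h m]. *)
Lemma excess_dichotomy (h : R) :
  0 < h -> h <= 1 / (2100 * 20) -> 200 <= h * m ->
  (3 - h) * m <= W -> bads R G <= 3 * h * m ^+ 2 ->
  (4 / 3 - 30 * (2100 * h)) * m ^+ 2 <= excess R G \/ near_book.
Proof.
move=> h0 h1 hm W3 hbad.
have m0 : 0 < m by rewrite -(pmulr_rgt0 _ h0); move: hm; clear; lra.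
pose t := 2100 * h * m.
have hm0 : 0 <= h * m by move: hm; clear; lra.
have t0 : 0 <= t by rewrite /t -mulrA; move: hm0; clear; lra.
have tm : t <= m / 20.
  have : h * m <= 1 / (2100 * 20) * m by rewrite ler_wpM2r // ltW.
  by rewrite /t -mulrA; move: m0; clear; lra.
have goalE : (4 / 3 - 30 * (2100 * h)) * m ^+ 2 = (4 / 3 * m - 30 * t) * m.
  by rewrite /t; ring.
have W3t : 3 * m - t <= W by move: W3 hm0; rewrite /t -mulrA; clear; lra.
rewrite goalE.
have [/existsP [u0 hu0]|] := boolP [exists u, m / 6 < dg u]; last first.
  rewrite negb_exists => /forallP hs; left.
  have hs' v : dg v <= m / 6 by rewrite leNgt.
  apply: le_trans (excess_small_degrees hs').
  have : m / 2 * (3 * m - t) <= m / 2 * W by rewrite ler_wpM2l // divr_ge0 // ltW.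
  have := sqr_ge0 m; have : 0 <= m * t by rewrite mulr_ge0 // ltW.
  by clear; set w := W; lra.
(* One third of the threshold [m / 6]: an edge avoiding [L] has degree sum below [m / 9], so
   [outside_le] applies to [u0] with [x = m / 18]. *)
pose L := [set v | m / 18 <= dg v]%SET.
have inL v : (v \in L) = (m / 18 <= dg v) by rewrite inE.
have m18 : 0 < m / 18 by move: m0; clear; lra.
have small v : v \notin L -> dg v < m / 18 by rewrite inL ltNge.
have Q1 : outside R L * (m / 18) <= bads R G.
  apply: (outside_le (u := u0)) => c /small; move: hu0; clear; lra.
have Q : outside R L <= 54 * (h * m).
  rewrite -(ler_pM2r m18); apply: le_trans Q1 _; apply: le_trans hbad _.
  by rewrite le_eqVlt; apply/orP; left; apply/eqP; field.
have kL : (#|L| <= 36)%N.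
  have : #|L|%:R * (m / 18) <= 36%:R * (m / 18).
    apply: (@le_trans _ _ (\sum_(v in L) dg v)).
      rewrite mulr_natl -sumr_const; apply: ler_sum => v; rewrite inL //.
    apply: (@le_trans _ _ (2 * m)); last by move: m0; clear; lra.
    rewrite -sum_degr [leRHS](bigID (mem L)) /= lerDl sumr_ge0 // => v _.
    exact: degr_ge0.
  by rewrite ler_pM2r // ler_nat.
have kR : #|L|%:R <= 36 :> R by rewrite -[36]/(36%:R) ler_nat.
have k0 : 0 <= #|L|%:R :> R by rewrite ler0n.
have twinN u v : u \in L -> v \in L -> \sum_z al v z * (1 - al u z) <= 55 * (h * m).
  move=> uL _; set n := \sum_z _.
  have n0 : 0 <= n.
    by apply: sumr_ge0 => z _; rewrite mulr_ge0 ?adjr_ge0 // subr_ge0 adjr_le1.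
  rewrite -(ler_pM2r m18) mulrC; apply: (@le_trans _ _ (dg u * n)).
    by rewrite ler_wpM2r // -inL.
  apply: le_trans (twins R u v) _.
  apply: (@le_trans _ _ (3 * h * m ^+ 2 + 2 * m)); first by rewrite lerD2r.
  rewrite (_ : _ + _ = (54 * (h * m) + 36) * (m / 18)); last by field.
  by rewrite ler_pM2r //; move: hm; clear; lra.
have twin u v : u \in L -> v \in L -> dg v - 55 * (h * m) <= codeg R u v.
  by move=> uL vL; rewrite codeg_twins lerD2l lerN2 twinN.
have degdiff u v : u \in L -> v \in L -> dg v <= dg u + 55 * (h * m).
  by move=> uL vL; have := twin u v uL vL; have := codeg_le u v; clear; lra.
have EL := sum_adjr_in_le_card L.
have EL0 : 0 <= \sum_(a in L) \sum_(b in L) al a b.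
  by do 2!apply: sumr_ge0 => ? _; exact: adjr_ge0.
have k2 : #|L|%:R ^+ 2 <= 36 ^+ 2 :> R by rewrite lerXn2r ?nnegrE.
have k3 : #|L|%:R ^+ 3 <= 36 ^+ 3 :> R by rewrite lerXn2r ?nnegrE.
have kh : #|L|%:R * (h * m) <= 36 * (h * m) by rewrite ler_wpM2r.
have Q0 := outside_ge0 R L.
have sumL := sum_degr_in R L.
have tE : t = 2100 * (h * m) by rewrite /t mulrA.
(* Degrees in [L] nearly agree, and [sum_degr_in] makes their sum nearly [m]. *)
have largeU v : v \in L -> #|L|%:R * dg v <= m + t.
  move=> vL; apply: (@le_trans _ _ (\sum_(u in L) (dg u + 55 * (h * m)))).
    rewrite mulr_natl -sumr_const; apply: ler_sum => u uL; exact: degdiff.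
  rewrite big_split /= sumL sumr_const -[_ *+ #|L|]mulr_natl tE.
  by move: EL EL0 k2 kh Q0 hm; clear; set S := \sum_(a in L) _; lra.
have largeL v : v \in L -> m - t <= #|L|%:R * dg v.
  move=> vL; have : \sum_(u in L) (dg u - 55 * (h * m)) <= #|L|%:R * dg v.
    rewrite [leRHS]mulr_natl -(sumr_const (mem L)); apply: ler_sum => u uL.
    by have := degdiff v u vL uL; clear; lra.
  rewrite big_split /= sumL sumr_const -[_ *+ #|L|]mulr_natl tE.
  by move: EL EL0 k2 kh Q0 Q hm; clear; set S := \sum_(a in L) _; lra.
(* At most 36 neighbours lie in [L]; the edges to the others avoid [L]. *)
have smallt v : v \notin L -> dg v <= t.
  move=> vL; rewrite /degr (bigID (mem L)) /= tE.
  have : \sum_(b in L) al v b <= #|L|%:R.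
    by rewrite -sum1_card natr_sum; apply: ler_sum => b _; exact: adjr_le1.
  have : \sum_(b | b \notin L) al v b <= outside R L.
    rewrite /outside [leRHS](bigD1 v) //= lerDl.
    by do 2!apply: sumr_ge0 => ? _; exact: adjr_ge0.
  by move: Q kR hm; clear; set S := \sum_(b in L) _; set S' := \sum_(b | _) _; lra.
have twint u v : u \in L -> v \in L -> dg v - t <= codeg R u v.
  by move=> uL vL; apply: le_trans (twin u v uL vL); rewrite tE; move: hm; clear; lra.
have outt : outside R L <= t by apply: le_trans Q _; rewrite tE; move: hm; clear; lra.
have L3 : 6 * #|L|%:R ^+ 3 <= t by rewrite tE; move: k3 hm; clear; lra.
have L1 : (0 < #|L|)%N.
  by apply/card_gt0P; exists u0; rewrite inL; move: hu0 m0; clear; lra.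
have LS : large_split L t by [].
have := excess_one LS; have := excess_two LS.
have := excess_three LS; have := excess_four LS.
case: #|L| L1 => [//|[|[|[|k]]]] _ E4 E3 E2 E1.
- by left; exact: E1.
- exact: E2.
- by left; exact: E3.
- by left; exact: E4.
Qed.

End Dichotomy.

(** * Graphs close to a book *)

Section NearBook.
Variables (R : realType) (G : sgraph).
Local Notation al := (@adjr R G).
Local Notation dg := (@degr R G).
Local Notation m := ((num_edges G)%:R : R).

Lemma sum_split2 (p q : G) (f : G -> R) : p != q ->
  \sum_b f b = f p + f q + \sum_(b | b \notin [set p; q]%SET) f b.
Proof.
move=> pq; rewrite (bigD1 p) //= (bigD1 q) 1?eq_sym //= addrA; congr (_ + _).
by apply: eq_bigl => b; rewrite !inE negb_or.
Qed.

(* All eigenvector entries outside a near-book spine are at most half the maximum,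
   because [rho^2 x_z] counts walks of length two from [z], few of which avoid
   the spine. *)
Lemma near_book_small (x : G -> R) (r X : R) (p q : G) :
  p != q -> outside R [set p; q]%SET <= m / 8 -> 16 <= r -> m <= r ^+ 2 ->
  (forall a, 0 <= x a) -> (forall a, x a <= X) ->
  (forall a, r * x a = \sum_b al a b * x b) ->
  forall z, z \notin [set p; q]%SET -> x z <= X / 2.
Proof.
move=> pq; set S := [set p; q]%SET; set Q := outside R S => hQ r16 mr x0 xX eig z zS.
have X0 : 0 <= X by apply: le_trans (xX p).
have row a : r * x a <= 2 * X + X * \sum_(b | b \notin S) al a b.
  rewrite eig (sum_split2 _ pq) mulr_sumr.
  have h y w : al y w * x w <= X.
    by rewrite -[leRHS]mul1r ler_pM ?adjr_ge0 ?adjr_le1.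
  have -> : 2 * X = X + X by ring.
  rewrite lerD //; first by rewrite lerD.
  by apply: ler_sum => b _; rewrite mulrC ler_wpM2r ?adjr_ge0.
have dz : \sum_(b | b \notin S) al z b <= Q.
  rewrite /Q /outside [leRHS](bigD1 z) //= lerDl.
  by do 2!apply: sumr_ge0 => ? _; exact: adjr_ge0.
(* The spine accounts for [2 r X]. At most [Q] further neighbours contribute [2 X] each through the
   spine, and walks staying off it contribute at most [Q X]. *)
have two : r * (r * x z) <= (2 * r + 3 * Q) * X.
  rewrite [r * x z]eig mulr_sumr (sum_split2 _ pq).
  have h w : r * (al z w * x w) <= r * X.
    rewrite ler_wpM2l; [by []|by move: r16; clear; lra|].
    by rewrite -[leRHS]mul1r ler_pM ?adjr_ge0 ?adjr_le1.
  have h2 : \sum_(b | b \notin S) r * (al z b * x b) <= 2 * X * Q + X * Q.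
    apply: (@le_trans _ _ (\sum_(b | b \notin S) (2 * X * al z b +
       X * \sum_(c | c \notin S) al b c))).
      apply: ler_sum => b _; rewrite mulrCA.
      apply: (@le_trans _ _ (al z b * (2 * X + X * \sum_(c | c \notin S) al b c))).
        by rewrite ler_wpM2l ?adjr_ge0.
      rewrite mulrDr [al z b * (2 * X)]mulrC lerD2l ler_piMl ?adjr_le1 // mulr_ge0 //.
      by apply: sumr_ge0 => ? _; exact: adjr_ge0.
    rewrite big_split /= -mulr_sumr -mulr_sumr lerD2r ler_wpM2l // mulr_ge0 //.
  by have := h p; have := h q; move: h2; clear; set Y := \sum_(b | _) _; lra.
have r2 : 0 < r ^+ 2 by rewrite exprn_gt0 //; move: r16; clear; lra.
(* Here [2 r <= r^2 / 8] and [3 Q <= 3 r^2 / 8], together [r^2 / 2]. *)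
rewrite -(ler_pM2l r2) expr2 -mulrA; apply: le_trans two _.
rewrite (_ : r * r * (X / 2) = r ^+ 2 / 2 * X); last by field.
rewrite ler_wpM2r //.
have : 16 * r <= r ^+ 2 by rewrite expr2 ler_wpM2r //; move: r16; clear; lra.
by move: hQ mr; clear; lra.
Qed.

(** Subtracting [r X = x q + A1] from the expansion of [r^2 X] bounds [(r^2 - r) X] by
    [(dp + dq + Q / 2) X = (m - 1) X]. Entries off the spine are at most [X / 2], so the [Q] darts
    avoiding it weigh exactly as much as the [Q / 2] edges. *)
Lemma near_book_spine_max (x : G -> R) (r : R) (p q : G) :
  adj p q -> outside R [set p; q]%SET <= m / 8 -> 1 <= codeg R p q ->
  16 <= r -> m <= r ^+ 2 ->
  (forall a, 0 <= x a) -> 0 < x p -> (forall a, x a <= x p) ->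
  (forall a, r * x a = \sum_b al a b * x b) -> r ^+ 2 - r <= m - 1.
Proof.
move=> apq hQ cod1 r16 mr x0 xp0 xX eig.
have pq : p != q by apply: contraTneq apq => ->; rewrite adj_irrefl.
have xz := near_book_small pq hQ r16 mr x0 xX eig.
set S := [set p; q]%SET in hQ xz; set X := x p in xp0 xX xz.
set Q := outside R S in hQ.
have alpq : al p q = 1 by rewrite /adjr apq.
have alqp : al q p = 1 by rewrite adjrC.
pose dp := \sum_(z | z \notin S) al p z; pose dq := \sum_(z | z \notin S) al q z.
pose A1 := \sum_(z | z \notin S) al p z * x z; pose A2 := \sum_(z | z \notin S) al q z * x z.
have codE : codeg R p q = \sum_(z | z \notin S) al p z * al z q.
  rewrite /codeg (sum_split2 _ pq) !adjrr mul0r mulr0 !add0r.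
  by apply: eq_bigr => z _; rewrite mulrC (adjrC R z p) (adjrC R q z).
set cod := codeg R p q in cod1 codE.
have ep : r * X = x q + A1 by rewrite eig (sum_split2 _ pq) adjrr alpq mul0r add0r mul1r.
have eq : r * x q = X + A2 by rewrite eig (sum_split2 _ pq) adjrr alqp mul0r addr0 mul1r.
have two : r * (r * X) = X + A2 + dp * X + cod * x q +
    \sum_(z | z \notin S) al p z * \sum_(b | b \notin S) al z b * x b.
  rewrite ep mulrDr eq codE /A1 mulr_sumr /dp !mulr_suml -!addrA; do 2!congr (_ + _).
  rewrite -!big_split; apply: eq_bigr => z zS /=.
  rewrite mulrCA eig (sum_split2 _ pq) (adjrC R z p) !mulrDr !mulrA adjr_sq addrA.
  by [].
have walk2 : \sum_(z | z \notin S) al p z * \sum_(b | b \notin S) al z b * x b <= Q * (X / 2).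
  rewrite /Q /outside mulr_suml; apply: ler_sum => z zS.
  rewrite mulr_suml; apply: (@le_trans _ _ (\sum_(b | b \notin S) al z b * x b)).
    rewrite ler_piMl ?adjr_le1 //; apply: sumr_ge0 => b _.
    by rewrite mulr_ge0 ?adjr_ge0.
  by apply: ler_sum => b bS; rewrite ler_wpM2l ?adjr_ge0 ?xz.
(* Common neighbours cancel, and neighbours of [p] alone contribute at most 0. *)
have A12 : A2 - A1 <= (dq - cod) * X.
  rewrite codE -!sumrB mulr_suml; apply: ler_sum => z _.
  rewrite -mulrBl (adjrC R z q); apply: (@le_trans _ _ ((al q z - al p z * al q z) * x z)).
    rewrite ler_wpM2r // lerD2l lerN2 ler_piMr ?adjr_ge0 ?adjr_le1 //.
  by rewrite ler_wpM2l // subr_ge0 ler_piMl ?adjr_ge0 ?adjr_le1.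
have mE : m - 1 = dp + dq + Q / 2.
  have := sum_adjr R G; rewrite (sum_split2 _ pq) (sum_split2 (al p) pq).
  rewrite (sum_split2 (al q) pq) !adjrr alpq alqp -/dp -/dq.
  have -> : \sum_(b | b \notin S) \sum_c al b c = dp + dq + Q.
    rewrite /dp /dq /Q /outside -!big_split; apply: eq_bigr => z _ /=.
    by rewrite (sum_split2 _ pq) (adjrC R z p) (adjrC R z q).
  by clear; lra.
rewrite mE -(ler_pM2r xp0).
have : (cod - 1) * x q <= (cod - 1) * X.
  by rewrite ler_wpM2l ?xX // subr_ge0.
move: two ep walk2 A12; clear; set Y := \sum_(z | _) _; lra.
Qed.

Lemma codegC (a b : G) : codeg R a b = codeg R b a.
Proof. by apply: eq_bigr => c _; rewrite mulrC (adjrC R c a) (adjrC R b c). Qed.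

(** The maximal entry lies on the spine by [near_book_small], and the near-book conditions are
    symmetric in its two ends. *)
Lemma near_book_rho (x : G -> R) (r : R) :
  near_book R G -> 16 <= r -> m <= r ^+ 2 ->
  (forall a, 0 <= x a) -> (exists a, 0 < x a) ->
  (forall a, r * x a = \sum_b al a b * x b) -> r ^+ 2 - r <= m - 1.
Proof.
move=> [p [q [apq hQ cod1]]] r16 mr x0 [a0 xa0] eig.
have [u _ umax0] := @Order.TotalTheory.arg_maxP _ _ _ a0 xpredT x isT.
have {umax0} umax a : x a <= x u by exact: umax0.
have xu0 : 0 < x u by exact: lt_le_trans (umax a0).
have [uS|uS] := boolP (u \in [set p; q]%SET); last first.
  have pq : p != q by apply: contraTneq apq => ->; rewrite adj_irrefl.
  have := near_book_small pq hQ r16 mr x0 umax eig uS.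
  by move: xu0; clear; lra.
move: uS; rewrite !inE => /orP[] /eqP e; rewrite {u}e in umax xu0.
  exact: (near_book_spine_max apq hQ cod1 r16 mr).
apply: (near_book_spine_max (p := q) (q := p)) => //; first by rewrite adj_sym.
- by rewrite finset.setUC.
- by rewrite codegC.
Qed.

End NearBook.

(** * The lower bound *)

(** The threshold is the larger root of [r^2 - r = x - 1]. *)
Lemma rho_quadratic (R : realType) (x r : R) : 1 <= x ->
  (1 + Num.sqrt (4 * x - 3)) / 2 < r -> x - 1 < r ^+ 2 - r.
Proof.
move=> x1 hr; have s0 := sqrtr_ge0 (4 * x - 3).
have s2 : Num.sqrt (4 * x - 3) ^+ 2 = 4 * x - 3.
  by rewrite sqr_sqrtr //; move: x1; clear; lra.
move: s0 s2 hr; set s := Num.sqrt _ => s0 s2 hr.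
have : s ^+ 2 < (2 * r - 1) ^+ 2 by rewrite ltrXn2r ?nnegrE //; move: hr s0; clear; lra.
by rewrite s2; clear; lra.
Qed.

Lemma closed3_le (R : realType) (G : sgraph) (a : G) :
  closed3 R a <= 2 * (num_edges G)%:R.
Proof.
rewrite -sum_adjr; apply: ler_sum => b _; apply: ler_sum => c _.
rewrite /tri mulrAC ler_piMl ?adjr_ge0 //.
by rewrite -[leRHS]mulr1 ler_pM ?adjr_ge0 ?adjr_le1.
Qed.

Lemma C5_count_ge (R : realType) (G : sgraph) (h : R) :
  let m : R := (num_edges G)%:R in
  0 < h -> h <= 1 / (2100 * 20) -> 300 * 23 ^+ 3 <= Num.sqrt m * h ^+ 2 ->
  (1 + Num.sqrt (4 * m - 3)) / 2 < rho R G ->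
  (2 / 9 - 6 * (2100 * h)) * m ^+ 2 <= (num_C5 G)%:R.
Proof.
move=> m h0 h1 hs hrho.
(* Few copies of [C5] bound [walks5], hence the fifth moment of the spectrum. *)
have [big|few] := leP (2 / 9 * m ^+ 2) (num_C5 G)%:R.
  apply: le_trans big; rewrite ler_wpM2r ?sqr_ge0 //; move: h0; clear; lra.
set s := Num.sqrt m in hs.
have m0 : 0 <= m by rewrite ler0n.
have s2 : s ^+ 2 = m by rewrite sqr_sqrtr.
have s4 : s ^+ 4 = m ^+ 2 by rewrite -s2 -exprM.
have h2 : 0 < h ^+ 2 by rewrite exprn_gt0.
have hle : h <= 1 by move: h1; clear; lra.
have hs' : 600 <= s * h ^+ 2.
  apply: le_trans hs; rewrite (_ : 600 = 300 * 2); last by ring.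
  apply: ler_wpM2l; first by rewrite ler0n.
  apply: (@le_trans _ _ 23); first by rewrite ler_nat.
  by rewrite exprS ler_peMr; [| | apply: exprn_ege1; rewrite ler1n].
have s0 : 0 < s by rewrite -(pmulr_lgt0 _ h2); move: hs'; clear; lra.
have sh : 600 <= s * h.
  by apply: le_trans hs' _; rewrite ler_wpM2l ?(ltW s0) // expr2 ler_piMl // ltW.
have s16 : 16 <= s.
  have : s * h <= s by rewrite ler_piMr // ltW.
  by move: sh; clear; lra.
have mge : 1 <= m by rewrite -s2 exprn_ege1 //; move: s16; clear; lra.
have rq := rho_quadratic mge hrho.
have r0 : 0 < rho R G.
  by apply: le_lt_trans hrho; rewrite divr_ge0 // addr_ge0 // sqrtr_ge0.
have [n [d [i0 [x [di0 [d2 d3 d4 d5] x0 xpos eig]]]]] := graph_spectrum r0.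
set r := rho R G in rq r0 di0 eig.
have T5 := walks5_le R G.
set E := \sum_a _ in T5.
have E4 : E <= 4 * m ^+ 2.
  apply: (@le_trans _ _ (\sum_a degr R a * (2 * m))).
    by apply: ler_sum => a _; rewrite ler_wpM2l ?degr_ge0 ?closed3_le.
  by rewrite -mulr_suml sum_degr /m le_eqVlt; apply/orP; left; apply/eqP; ring.
have sr : s <= r.
  rewrite leNgt; apply/negP => rs.
  have : 0 <= (s - r) * (s + r - 1).
    by apply: mulr_ge0; move: rs r0 s16; clear; lra.
  by move: rq s16; rewrite -s2; clear; lra.
have mr : m <= r ^+ 2 by rewrite -s2 lerXn2r ?nnegrE ?(ltW s0) ?(ltW r0).
(* The constant 23 dominates [10 * 2/9 + 5 * 4], from [few] and [E4]. *)
have [|||||||M3 M3' M4 M5] := @moment_estimates R n d i0 s 23 h.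
- by rewrite ler1n.
- by rewrite h0 hle.
- exact: hs.
- by rewrite di0.
- by rewrite di0 s2.
- by rewrite d2 sum_adjr s2.
- by rewrite d5 s4; move: T5 E4 few (sqr_ge0 m); clear; set w := walks5 R G; lra.
rewrite ?d3 ?d4 ?d5 ?s2 ?s4 in M3 M3' M4 M5.
have bl := bads_le (ltW s0) (eq_ind _ (fun y => _ <= y) (lexx _) _ (esym s2)).
(* The fourth moment leaves [2 h m^2], and [414 s m <= h m^2] because [s h >= 600]. *)
have hb : bads R G <= 3 * h * m ^+ 2.
  have e1 : 2 * s * walks3 R G <= 2 * s * (9 * 23 * m).
    by rewrite ler_wpM2l // mulr_ge0 // ltW.
  have e2 : s * 414 * m <= s * (s * h) * m.
    rewrite ler_wpM2r // ler_wpM2l ?(ltW s0) //; move: sh; clear; lra.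
  have e3 : s * (s * h) * m = h * m ^+ 2 by rewrite -s2; ring.
  move: bl e1 e2 M4; rewrite e3 -/m; clear.
  set w3 := walks3 R G; set w4 := walks4 R G; set b := bads R G; lra.
have hm : 200 <= h * m.
  have : s * h <= m * h.
    by rewrite ler_wpM2r ?(ltW h0) // -s2 expr2 ler_peMl ?(ltW s0) //; move: s16; clear; lra.
  by move: sh; clear; lra.
have [X|nb] := excess_dichotomy h0 h1 hm M3 hb; last first.
  have := near_book_rho nb (le_trans s16 sr) mr x0 xpos eig.
  by rewrite leNgt rq.
(* Ten times the number of copies is at least [5/3] of the excess minus [h m^2]; thus [4/3] becomes
   [2/9], and the error [5 * 2100 h + h / 10] is below [6 * 2100 h]. *)
move: X; rewrite excessE -/m -/E.
have : 0 <= h * m ^+ 2 by rewrite mulr_ge0 ?(ltW h0) ?sqr_ge0.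
move: T5 M5; clear.
set w3 := walks3 R G; set w5 := walks5 R G; lra.
Qed.

Lemma le_sqrt_sqrt (R : rcfType) (x y : R) : 0 <= y -> y ^+ 4 <= x ->
  y <= Num.sqrt (Num.sqrt x).
Proof.
move=> y0 yx; have -> : y = Num.sqrt (Num.sqrt (y ^+ 4)).
  by rewrite (exprM y 2 2) sqrtr_sqr ger0_norm ?sqr_ge0 // sqrtr_sqr ger0_norm.
exact/ler_wsqrtr/ler_wsqrtr.
Qed.

Lemma cvg_div_sqrt_sqrt (R : realType) (K : R) : 0 <= K ->
  ((fun n : nat => K / Num.sqrt (Num.sqrt n%:R)) @ \oo --> (0 : R))%classic.
Proof.
move=> K0; apply/cvgrPdist_lt => e e0.
pose B := Num.bound (((K + 1) / e) ^+ 4).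
exists B => // n /= Bn; rewrite sub0r normrN.
have y0 : 0 < (K + 1) / e by rewrite divr_gt0 // ltr_wpDl.
have yn : (K + 1) / e <= Num.sqrt (Num.sqrt n%:R).
  apply: le_sqrt_sqrt; first exact: ltW.
  apply: le_trans (ltW (archi_boundP (exprn_ge0 4 (ltW y0)))) _.
  by rewrite ler_nat.
have q0 : 0 < Num.sqrt (Num.sqrt n%:R : R) by exact: lt_le_trans yn.
rewrite ger0_norm ?divr_ge0 ?(ltW q0) // ltr_pdivrMr //.
apply: lt_le_trans (ler_wpM2l (ltW e0) yn).
by rewrite mulrC divfK ?gt_eqF // ltrDl.
Qed.

Lemma C5_lower_bound_two_ninths (R : realType) : C5_lower_bound (2 / 9 : R).
Proof.
(* The choice is [h = c / m^(1/4)], for which [sqrt m * h^2 = c^2 >= 300 * 23^3]; once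
   [m^(1/4) >= c D], also [h <= 1 / D]. The error term is then [K / m^(1/4)]. *)
have [c c0 cE] : exists2 c : R, 0 < c & c = 23 * 100.
  by exists (23 * 100); [apply: mulr_gt0; rewrite ltr0n | by []].
have [D D0 DE] : exists2 D : R, 0 < D & D = 2100 * 20.
  by exists (2100 * 20); [apply: mulr_gt0; rewrite ltr0n | by []].
have [K K0 KE] : exists2 K : R, 0 <= K & K = 6 * (2100 * c).
  exists (6 * (2100 * c)); last by [].
  by apply: mulr_ge0; [rewrite ler0n | apply: mulr_ge0; [rewrite ler0n | exact: ltW]].
exists (fun n => K / Num.sqrt (Num.sqrt n%:R)); split; first exact: cvg_div_sqrt_sqrt.
exists (Num.bound ((c * D) ^+ 4)) => m mB G Gm hrho.
set q := Num.sqrt (Num.sqrt m%:R).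
have y0 : 0 < c * D by rewrite mulr_gt0.
have yq : c * D <= q.
  apply: le_sqrt_sqrt; first exact: ltW.
  apply: le_trans (ltW (archi_boundP (exprn_ge0 4 (ltW y0)))) _.
  by rewrite ler_nat.
have q0 : 0 < q by exact: lt_le_trans yq.
have q2 : q ^+ 2 = Num.sqrt m%:R by rewrite sqr_sqrtr // sqrtr_ge0.
have -> : K / q = 6 * (2100 * (c / q)) by rewrite KE -!mulrA.
rewrite -Gm; apply: C5_count_ge; rewrite ?Gm.
- exact: divr_gt0.
- by rewrite -DE ler_pdivrMr // mulrC mulrA mulr1 ler_pdivlMr.
- have -> : Num.sqrt m%:R * (c / q) ^+ 2 = c ^+ 2.
    by rewrite -q2 -exprMn mulrC divfK // gt_eqF.
  rewrite cE exprMn (exprS 23 2).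
  rewrite mulrA [leRHS]mulrC; apply: ler_wpM2r; first by rewrite exprn_ge0 // ler0n.
  by rewrite expr2; lra.
- exact: hrho.
Qed.

(** * Optimality *)

Lemma rho_ge_eigenvalue (R : realType) (G : sgraph) (x : G -> R) (l : R) :
  0 <= l -> (exists a, x a != 0) -> (forall a, l * x a = \sum_b adjr R a b * x b) ->
  l <= rho R G.
Proof.
move=> l0 [a xa] eig.
have [d [_ deig _ _]] := spectral_real_symmetric (adj_mx_sym R G).
have normr (y : R) : ComplexField.Normc.normc y%:C%C = `|y|.
  by rewrite /= expr0n addr0 sqrtr_sqr.
rewrite /rho /spectral_radius; apply: ub_le_sup; last first.
  exists l%:C%C; last by rewrite normr ger0_norm.
  apply/eigenvalueP; exists (map_mx (real_complex R) (\row_i x (enum_val i))).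
    rewrite -map_mxM; apply/rowP => j; rewrite !mxE -rmorphM eig; congr (_%:C)%C.
    by rewrite -adj_mx_mulE mxE.
  apply/rV0Pn; exists (enum_rank a); rewrite !mxE enum_rankK.
  by rewrite fmorph_eq0.
(* Boundedness of the set of moduli, which makes its supremum an upper bound. *)
exists (\sum_i `|d i|) => _ [z /deig [i ->] <-].
by rewrite normr (bigD1 i) //= lerDl sumr_ge0.
Qed.

(** * Size and spectral radius of the extremal graphs *)

Section JoinPath.
Variable s : nat.

(* The path on three vertices, centred at [ord0], joined to [s] isolated vertices. *)
Definition join_adj : rel ('I_3 + 'I_s) := fun a b =>
  match a, b with
  | inl i, inl j => (i == ord0) != (j == ord0)
  | inr _, inr _ => false
  | _, _ => true
  end.

Lemma join_adj_sym : symmetric join_adj.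
Proof. by move=> [i|i] [j|j] //=; rewrite eq_sym. Qed.

Lemma join_adj_irrefl : irreflexive join_adj.
Proof. by move=> [i|i] //=; rewrite eqxx. Qed.

Definition join_path : sgraph := SGraph join_adj_sym join_adj_irrefl.

Lemma sum_join (R : realType) (f : join_path -> R) :
  \sum_a f a = f (inl ord0) + f (inl (lift ord0 ord0)) + f (inl (lift ord0 (lift ord0 ord0)))
    + \sum_i f (inr i).
Proof.
by rewrite big_sumType /= !big_ord_recl big_ord0 addr0 !addrA.
Qed.

Lemma num_edges_join (R : realType) : (num_edges join_path)%:R = 3 * s%:R + 2 :> R.
Proof.
have rB i : \sum_b adjr R (inr i : join_path) b = 3.
  rewrite sum_join /adjr /= big1 //; clear; lra.
have := sum_adjr R join_path; rewrite sum_join.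
rewrite [X in _ + X](eq_bigr _ (fun i _ => rB i)) !sum_join /adjr /=.
by rewrite !sumr_const !card_ord -(mulr_natl 3 s); clear; lra.
Qed.

(** An eigenvector constant on the centre, the two ends and the independent part exists for each
    positive root of the cubic [P]. The threshold [l0] satisfies [P(l0) = 1 - s < 0] and
    [P(m) >= 0], so a root lies above [l0]. *)
Lemma rho_join (R : realType) : (2 <= s)%N ->
  (1 + Num.sqrt (4 * (num_edges join_path)%:R - 3)) / 2 < rho R join_path.
Proof.
move=> s2; have := num_edges_join R; move: (_%:R : R) => m mE.
have sR : 2 <= s%:R :> R by rewrite ler_nat.
have q0 := sqrtr_ge0 (4 * m - 3).
have q2 : Num.sqrt (4 * m - 3) ^+ 2 = 4 * m - 3.
  by rewrite sqr_sqrtr // mE; move: sR; clear; lra.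
set q := Num.sqrt _ in q0 q2 *; set l0 := (1 + q) / 2.
have l0E : l0 ^+ 2 = l0 + m - 1 by rewrite /l0; move: q2; clear; lra.
have l00 : 0 < l0 by rewrite /l0; move: q0; clear; lra.
pose P : {poly R} := 'X^3 - m *: 'X - (4 * s%:R)%:P.
have PE x : P.[x] = x ^+ 3 - m * x - 4 * s%:R by rewrite /P !hornerE.
have Pl0 : P.[l0] < 0.
  rewrite PE (_ : l0 ^+ 3 = l0 + m - 1 + (m - 1) * l0); last first.
    by rewrite exprS l0E mulrBr mulrDr mulr1 -expr2 l0E; ring.
  by rewrite mE; move: sR; clear; lra.
have m8 : 8 <= m by rewrite mE; move: sR; clear; lra.
have l0m : l0 <= m.
  rewrite -ler_sqr ?nnegrE ?(ltW l00) //; last by move: m8; clear; lra.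
  have : q <= m.
    rewrite -ler_sqr ?nnegrE // ?q2; last by move: m8; clear; lra.
    by have : 8 * m <= m ^+ 2; [rewrite expr2 ler_wpM2r //|]; move: m8; clear; lra.
  have : 8 * m <= m ^+ 2 by rewrite expr2 ler_wpM2r //; move: m8; clear; lra.
  by rewrite l0E /l0; move: m8; clear; lra.
have Pm : 0 <= P.[m].
  rewrite PE.
  have e1 : 8 * m <= m ^+ 2 by rewrite expr2 ler_wpM2r //; move: m8; clear; lra.
  have e2 : 8 * (m ^+ 2) <= m ^+ 3 by rewrite (exprS m 2) ler_wpM2r // sqr_ge0.
  by move: e1 e2 mE sR; clear; lra.
have [l /andP[l0l _] /rootP Pl] : exists2 l, l0 <= l <= m & root P l.
  by apply: poly_ivt => //; rewrite (ltW Pl0).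
have {l0l} l0l : l0 < l.
  by rewrite lt_neqAle l0l andbT; apply: contraTneq Pl0 => ->; rewrite Pl ltxx.
have lp : 0 < l by exact: lt_trans l0l.
have ln0 : l != 0 by rewrite gt_eqF.
apply: (lt_le_trans l0l).
pose x (a : join_path) : R := match a with
  | inl i => if i == ord0 then l + 2 else l + 1
  | inr _ => (3 * l + 4) / l end.
apply: (rho_ge_eigenvalue (x := x)); first exact: ltW.
  by exists (inl ord0); rewrite /= gt_eqF //; move: lp; clear; lra.
have cubic : s%:R * ((3 * l + 4) / l) = l ^+ 2 - 2.
  rewrite mulrA; apply/eqP; rewrite eq_sym -(inj_eq (mulIf ln0)) divfK //; apply/eqP.
  by move: Pl; rewrite PE mE; clear; lra.
have sumB : \sum_(i < s) (1 : R) * ((3 * l + 4) / l) = l ^+ 2 - 2.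
  by rewrite sumr_const card_ord mul1r -cubic [RHS]mulr_natl.
move=> [[[|[|[|i]]] hi]|i] //; rewrite sum_join /adjr /= ?sumB.
- by ring.
- by ring.
- by ring.
- rewrite [\sum_(j < s) _]big1 => [|j _]; last by rewrite mul0r.
  by rewrite [LHS]mulrC (divfK ln0); ring.
Qed.

End JoinPath.

(** * Copies of [C5] in the extremal graphs *)

Lemma C5_image_aut (G : sgraph) (f : {ffun 'I_5 -> G}) (g : 'I_5 -> 'I_5) :
  injective g -> (forall i j, C5_adj (g i) (g j) = C5_adj i j) ->
  C5_image [ffun i => f (g i)] = C5_image f.
Proof.
move=> gI gA; have [h gK hK] := injF_bij gI.
have hA i j : C5_adj (h i) (h j) = C5_adj i j by rewrite -gA !hK.
rewrite /C5_image; congr (_, _).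
  apply/setP => y; apply/imsetP/imsetP => -[i _ ->].
    by exists (g i) => //; rewrite ffunE.
  by exists (h i) => //; rewrite ffunE hK.
apply/setP => y; apply/imsetP/imsetP => -[A /imsetP [[p q]]]; rewrite inE /= => pq -> ->.
  exists [set g p; g q]%SET; last by rewrite !imsetU1 !imset_set1 !ffunE.
  by apply/imsetP; exists (g p, g q) => //; rewrite inE /= gA.
exists [set h p; h q]%SET; last by rewrite !imsetU1 !imset_set1 !ffunE !hK.
by apply/imsetP; exists (h p, h q) => //; rewrite inE /= hA.
Qed.

Lemma copies_C5_image (G : sgraph) S : S \in copies C5 G ->
  exists2 f, f \in C5_homs G & S = C5_image f.
Proof.
rewrite inE => /andP[/fintype.subsetP sub /existsP [f /and3P [fI /eqP S1 /eqP S2]]].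
exists f; last by case: S S1 S2 {sub} => A B /= -> ->.
rewrite inE fI; apply/forallP => i.
have : [set f i; f (ordS i)]%SET \in edges G.
  apply: sub; rewrite S2; apply/imsetP; exists [set i; ordS i]%SET.
    by apply/imsetP; exists (i, ordS i) => //; rewrite inE /= /C5_adj eqxx.
  by rewrite imsetU1 imset_set1.
by move=> /imsetP [[a b]]; rewrite inE /= => ab /set2_eq [] [-> ->] //; rewrite adj_sym.
Qed.

Definition rot5 (k : nat) (i : 'I_5) : 'I_5 := iter k (@ordS 5) i.

Definition neg5 (i : 'I_5) : 'I_5 := @Zp_opp 5 i.

Lemma rot5_inj k : injective (rot5 k).
Proof. by elim: k => [|k IH] i j //= /ordS_inj /IH. Qed.

Lemma rot5_adj k i j : C5_adj (rot5 k i) (rot5 k j) = C5_adj i j.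
Proof.
by elim: k => //= k IH; rewrite -[RHS]IH /C5_adj !(inj_eq (@ordS_inj 5)).
Qed.

Lemma rot5S k i : rot5 k (ordS i) = ordS (rot5 k i).
Proof. by rewrite /rot5 -iterSr. Qed.

Lemma neg5_inj : injective neg5.
Proof.
move=> i j /(congr1 val) /=.
by case: i => [[|[|[|[|[|i]]]]] hi]; case: j => [[|[|[|[|[|j]]]]] hj] //= _; exact: val_inj.
Qed.

Lemma neg5_adj i j : C5_adj (neg5 i) (neg5 j) = C5_adj i j.
Proof.
by case: i => [[|[|[|[|[|i]]]]] hi]; case: j => [[|[|[|[|[|j]]]]] hj].
Qed.

Lemma rot5_surj i : exists k, i = rot5 k ord0.
Proof.
by case/or4P: (C5_cover i) => [/eqP->|/eqP->|/eqP->|/orP[/eqP->|/eqP->]];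
  [exists 0|exists 1|exists 2|exists 3|exists 4].
Qed.

Section CyclesInJoin.
Variable s : nat.
Local Notation G := (join_path s).

(** The boolean selects the end of the path at position 0; the centre and the other end are at
    positions 2 and 3. Position 4 is past the list, so it is the default [inr b2]. *)
Definition join_cycle (p : bool * 'I_s * 'I_s) : {ffun 'I_5 -> G} :=
  let: (e, b1, b2) := p in
  let u : 'I_3 := lift ord0 ord0 in let v : 'I_3 := lift ord0 (lift ord0 ord0) in
  [ffun i : 'I_5 => nth (inr b2) [:: inl (if e then u else v); inr b1; inl ord0;
                                     inl (if e then v else u)] i].

Definition in_indep (v : G) : bool := if v is inr _ then true else false.

(* At most three vertices of the cycle lie on the path, and no two consecutive
   ones lie in the independent part. *)
Lemma C5_indep_pair (f : {ffun 'I_5 -> G}) : f \in C5_homs G ->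
  exists i, in_indep (f (ordS i)) && in_indep (f (ordS (ordS (ordS (ordS i))))).
Proof.
rewrite inE => /andP[/injectiveP fI /forallP fA].
have nadj i : ~~ (in_indep (f i) && in_indep (f (ordS i))).
  by have := fA i; case: (f i) => [?|?]; case: (f (ordS i)).
have card3 : (\sum_i ~~ in_indep (f i) <= 3)%N.
  rewrite -[X in (_ <= X)%N]card_ord -big_mkcond sum1_card /=.
  pose g i : 'I_3 := if f i is inl k then k else ord0.
  rewrite -(@card_in_imset _ _ g); first exact: max_card.
  rewrite /g => i j fi fj e; apply: fI; move: fi fj e; rewrite /in_mem /=.
  by case: (f i) => [?|?] //; case: (f j) => [?|?] // _ _ ->.
have := nadj ord0; have := nadj (ordS ord0); have := nadj (ordS (ordS ord0)).
have := nadj (ordS (ordS (ordS ord0))); have := nadj (ordS (ordS (ordS (ordS ord0)))).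
have S5 (i : 'I_5) : ordS (ordS (ordS (ordS (ordS i)))) = i.
  by case: i => [[|[|[|[|[|i]]]]] hi] //; exact: val_inj.
have E : (\sum_i ~~ in_indep (f i) = ~~ in_indep (f ord0) + ~~ in_indep (f (ordS ord0)) +
   ~~ in_indep (f (ordS (ordS ord0))) + ~~ in_indep (f (ordS (ordS (ordS ord0)))) +
   ~~ in_indep (f (ordS (ordS (ordS (ordS ord0))))))%N.
  rewrite !big_ord_recl big_ord0 addn0 !addnA.
  by do ![congr (_ + _)%N]; congr (nat_of_bool (~~ in_indep (f _))); exact: val_inj.
rewrite S5; move: card3; rewrite E.
case e0: (in_indep (f ord0)); case e1: (in_indep (f (ordS ord0)));
case e2: (in_indep (f (ordS (ordS ord0))));
case e3: (in_indep (f (ordS (ordS (ordS ord0)))));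
case e4: (in_indep (f (ordS (ordS (ordS (ordS ord0)))))) => // _ _ _ _ _ _.
- by exists (ordS ord0); rewrite S5 e2 e0.
- by exists (ordS (ordS (ordS (ordS ord0)))); rewrite !S5 e0 e3.
- by exists (ordS (ordS ord0)); rewrite S5 e3 e1.
- by exists ord0; rewrite e1 e4.
- by exists (ordS (ordS (ordS ord0))); rewrite S5 e4 e2.
Qed.

(** Positions 0, 2 and 3 are the three path vertices, and 2, 3 are adjacent, so one of these is the
    centre. If it is at position 3, a reflection moves it to position 2. *)
Lemma C5_canonical (f : {ffun 'I_5 -> G}) : f \in C5_homs G ->
  in_indep (f (ordS ord0)) -> in_indep (f (ordS (ordS (ordS (ordS ord0))))) ->
  exists p, C5_image f = C5_image (join_cycle p).
Proof.
rewrite inE => /andP[/injectiveP fI /forallP fA].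
have dist i j : i != j -> f i != f j by rewrite (inj_eq fI).
have A0 := fA ord0; have A1 := fA (ordS ord0); have A2 := fA (ordS (ordS ord0)).
have A3 := fA (ordS (ordS (ordS ord0))).
have D02 := dist ord0 (ordS (ordS ord0)) isT.
have D03 := dist ord0 (ordS (ordS (ordS ord0))) isT.
have fE (g : {ffun 'I_5 -> G}) (p : bool * 'I_s * 'I_s) :
    g ord0 = join_cycle p ord0 -> g (ordS ord0) = join_cycle p (ordS ord0) ->
    g (ordS (ordS ord0)) = join_cycle p (ordS (ordS ord0)) ->
    g (ordS (ordS (ordS ord0))) = join_cycle p (ordS (ordS (ordS ord0))) ->
    g (ordS (ordS (ordS (ordS ord0)))) = join_cycle p (ordS (ordS (ordS (ordS ord0)))) ->
    g = join_cycle p.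
  move=> h0 h1 h2 h3 h4; apply/ffunP => i.
  by case/or4P: (C5_cover i) => [/eqP->|/eqP->|/eqP->|/orP[/eqP->|/eqP->]].
have three (k : 'I_3) : [|| k == ord0, k == lift ord0 ord0 | k == lift ord0 (lift ord0 ord0)].
  by case: k => [[|[|[|k]]] hk].
case f1: (f (ordS ord0)) A0 A1 => [//|b1].
case f4: (f (ordS (ordS (ordS (ordS ord0))))) A3 => [//|b2].
case f0: (f ord0) D02 D03 => [w|//]; case f2: (f (ordS (ordS ord0))) A2 => [u|//].
case f3: (f (ordS (ordS (ordS ord0)))) => [v|//] /= uv wu wv _ _ _ _ _.
have {}wu : w != u by apply: contraNneq wu => ->.
have {}wv : w != v by apply: contraNneq wv => ->.
have fN : C5_image f = C5_image [ffun i => f (neg5 i)].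
  by rewrite C5_image_aut //; [exact: neg5_inj | exact: neg5_adj].
have n0 : neg5 ord0 = ord0 by exact: val_inj.
have n1 : neg5 (ordS ord0) = ordS (ordS (ordS (ordS ord0))) by exact: val_inj.
have n2 : neg5 (ordS (ordS ord0)) = ordS (ordS (ordS ord0)) by exact: val_inj.
have n3 : neg5 (ordS (ordS (ordS ord0))) = ordS (ordS ord0) by exact: val_inj.
have n4 : neg5 (ordS (ordS (ordS (ordS ord0)))) = ordS ord0 by exact: val_inj.
case/or3P: (three w) wu wv f0 => /eqP-> wu wv f0;
case/or3P: (three u) wu uv f2 => /eqP-> wu uv f2 //;
case/or3P: (three v) wv uv f3 => /eqP-> wv uv f3 //.
- exists (true, b1, b2); apply: (congr1 (@C5_image G)).
  by apply: fE; rewrite [RHS]ffunE /= ?f0 ?f1 ?f2 ?f3 ?f4.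
- exists (true, b2, b1); rewrite fN; apply: (congr1 (@C5_image G)).
  by apply: fE; rewrite [LHS]ffunE [RHS]ffunE /= ?n0 ?n1 ?n2 ?n3 ?n4 ?f0 ?f1 ?f2 ?f3 ?f4.
- exists (false, b1, b2); apply: (congr1 (@C5_image G)).
  by apply: fE; rewrite [RHS]ffunE /= ?f0 ?f1 ?f2 ?f3 ?f4.
- exists (false, b2, b1); rewrite fN; apply: (congr1 (@C5_image G)).
  by apply: fE; rewrite [LHS]ffunE [RHS]ffunE /= ?n0 ?n1 ?n2 ?n3 ?n4 ?f0 ?f1 ?f2 ?f3 ?f4.
Qed.

(** After a rotation the independent vertices sit at positions 1 and 4, so every copy is the image
    of one of the [2 s^2] triples. *)
Lemma num_C5_join_le : (num_C5 G <= 2 * s * s)%N.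
Proof.
have <- : #|{: bool * 'I_s * 'I_s}| = (2 * s * s)%N.
  by rewrite !card_prod card_bool !card_ord.
apply: leq_trans (leq_imset_card (fun p => C5_image (join_cycle p)) predT).
apply: subset_leq_card; apply/fintype.subsetP => S /copies_C5_image [f fH ->].
have [i /andP[i1 i4]] := C5_indep_pair fH; have [k ik] := rot5_surj i.
have fk : C5_image f = C5_image [ffun j => f (rot5 k j)].
  by rewrite C5_image_aut //; [exact: rot5_inj | exact: rot5_adj].
rewrite fk; have [||| p ->] := @C5_canonical [ffun j => f (rot5 k j)].
- move: fH; rewrite !inE => /andP[/injectiveP fI /forallP fA]; apply/andP; split.
    by apply/injectiveP => j l; rewrite !ffunE => /fI /rot5_inj.
  by apply/forallP => j; rewrite !ffunE rot5S.
- by rewrite ffunE rot5S -ik.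
- by rewrite ffunE !rot5S -ik.
by apply: imset_f.
Qed.

End CyclesInJoin.

Theorem corollary1p2 (R : realType) :
  C5_lower_bound (2 / 9 : R) /\
  (forall c : R, 2 / 9 < c -> ~ C5_lower_bound c).
Proof.
split; first exact: C5_lower_bound_two_ninths.
move=> c hc [eps [/cvgrPdist_lt cv [m0 H]]].
have [N _ hN] : (\forall n \near \oo, `|0 - eps n| < c - 2 / 9)%classic.
  by apply: cv; rewrite subr_gt0.
(* Makes [m = 3 s + 2] exceed both [m0] and [N], with [s >= 2] for [rho_join]. The contradiction is
   [2 s^2 < (2/9) (3 s + 2)^2]. *)
pose s := (2 + m0 + N)%N.
have mE := num_edges_join s R.
have mN : num_edges (join_path s) = (3 * s + 2)%N.
  by apply/eqP; rewrite -(eqr_nat R) mE natrD natrM.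
have s2 : (2 <= s)%N by rewrite /s -addnA leq_addr.
have {}hN : `|0 - eps (num_edges (join_path s))| < c - 2 / 9.
  by apply: hN; rewrite /= mN /s; lia.
have {}H : (c - eps (num_edges (join_path s))) * (num_edges (join_path s))%:R ^+ 2 <=
    (num_C5 (join_path s))%:R.
  by apply: H => //; [rewrite mN /s; lia | exact: rho_join].
have : (num_C5 (join_path s))%:R <= 2 * s%:R * s%:R :> R.
  by rewrite -!natrM ler_nat num_C5_join_le.
move: hN H mE; rewrite sub0r normrN ltr_norml => /andP[_].
move: (eps _) (_%:R : R) (num_C5 _)%:R => e m n he H mE hn.
have s0 : 0 <= s%:R :> R by rewrite ler0n.
have m1 : 0 < m ^+ 2 by rewrite mE exprn_gt0 //; move: s0; clear; lra.
have : 2 / 9 * m ^+ 2 < (c - e) * m ^+ 2.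
  by rewrite ltr_pM2r //; move: he; clear; lra.
by rewrite mE in H *; have := sqr_ge0 (s%:R : R); move: H hn s0; clear; lra.
Qed.
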